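(* Let $D:\mathcal V(\delta^2)\to\mathcal V(\delta^2)$ be an $\ell^\infty$-bounded Haar multiplier. Then for every non-principal ultrafilter $\mathcal U$ on $\mathbb N$ and every $\eta>0$ there exists a bi-parameter faithful Haar system $\tilde H\otimes\tilde K$ relative to some frequencies $(m_i)_{i=0}^\infty$ and $(n_j)_{j=0}^\infty$ such that $$\Big\|D|_{\tilde H\otimes\tilde K}-\Big(\lambda_{\mathcal U}(D)\,\mathcal C+\mu_{\mathcal U}(D)(\mathrm{Id}-\mathcal C)\Big)\Big\|_{\mathrm T^2}<\eta,$$ and $\lambda_{\mathcal U}(D)=\lambda_{\mathcal U}(D|_{\tilde H\otimes\tilde K})$, $\mu_{\mathcal U}(D)=\mu_{\mathcal U}(D|_{\tilde H\otimes\tilde K})$.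
   Context: Haar functions. $\mathcal D$ is the set of dyadic intervals in $[0,1)$, $\mathcal D_j=\{I\in\mathcal D:|I|=2^{-j}\}$, $j\ge0$. For $I\in\mathcal D$, $I^{+}=I^{+1}$ and $I^-=I^{-1}$ are its left and right halves, $h_I=\chi_{I^+}-\chi_{I^-}$; $(k_J)$ is a copy of $(h_I)$. $\mathcal V(\delta)=\mathrm{span}\{h_I:I\in\mathcal D\}$; $(h_I\otimes k_J)(s,t)=h_I(s)k_J(t)$; $\mathcal V(\delta^2)=\mathrm{span}\{h_I\otimes k_J:I,J\in\mathcal D\}$; $\langle f,g\rangle=\int_0^1\int_0^1fg\,ds\,dt$. A Haar multiplier on $\mathcal V(\delta^2)$ is a linear operator $D$ with $D(h_I\otimes k_J)=d_{I,J}h_I\otimes k_J$, $d_{I,J}\in\mathbb R$; it is $\ell^\infty$-bounded if $\|D\|_\infty=\sup_{I,J}|d_{I,J}|<\infty$. The Capon projection $\mathcal C$ is the Haar multiplier with coefficient $1$ if $|I|\le|J|$ and $0$ if $|I|>|J|$. Functionals. For a non-principal ultrafilter $\mathcal U$ on $\mathbb N$, $$\lambda_{\mathcal U}(D)=\lim_{j\to\mathcal U}\lim_{i\to\mathcal U}\sum_{I\in\mathcal D_i}\sum_{J\in\mathcal D_j}|I||J|d_{I,J},\qquad \mu_{\mathcal U}(D)=\lim_{i\to\mathcal U}\lim_{j\to\mathcal U}\sum_{I\in\mathcal D_i}\sum_{J\in\mathcal D_j}|I||J|d_{I,J}.$$ Bi-tree variation (semi-)norm. With $\omega,\xi$ ranging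 over $\{\pm1\}$, $$\|D\|_{\mathrm T^2\mathrm S}=\sum_{k=0}^\infty(k+1)\max_{I,J\in\mathcal D_k,\,\omega,\xi}|d_{I,J}-d_{I^\omega,J^\xi}|+\sum_{k=0}^\infty(k+1)\max_{I\in\mathcal D_k,\,J\in\mathcal D_{k+1},\,\omega,\xi}|d_{I,J}-d_{I^\omega,J^\xi}|$$ $$\qquad+\sum_{i=0}^\infty\sum_{j=0}^i\max_{I\in\mathcal D_i,\,J\in\mathcal D_j,\,\omega}|d_{I,J}-d_{I^\omega,J}|+\sum_{j=0}^\infty\sum_{i=0}^j\max_{I\in\mathcal D_i,\,J\in\mathcal D_{j+1},\,\xi}|d_{I,J}-d_{I,J^\xi}|,$$ $$\|D\|_{\mathrm T^2}=\|D\|_{\mathrm T^2\mathrm S}+|d_{[0,1),[0,1)}|+|d_{[0,1),[0,1/2)}|+|d_{[0,1),[1/2,1)}|.$$ Faithful Haar systems. A family $(\tilde h_I)_{I\in\mathcal D}$ in $\mathcal V(\delta)$ is a faithful Haar system if (a) for each $I$ there is a finite family $\mathcal A_I\subset\mathcal D$ of pairwise disjoint intervals and signs $\varepsilon_K=\pm1$ with $\tilde h_I=\sum_{K\in\mathcal A_I}\varepsilon_Kh_K$; (b) with $\Gamma_I=\bigcup\mathcal A_I$, $\Gamma_{[0,1)}=[0,1)$, $\Gamma_{I^+}=\{\tilde h_I=1\}$ and $\Gamma_{I^-}=\{\tilde h_I=-1\}$ for all $I$. It is relative to the frequencies $(m_i)_{i=0}^\infty$ (a strictly increasing sequence in $\mathbb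 N_0$) if in addition $\mathcal A_I\subset\mathcal D_{m_i}$ for all $i$ and $I\in\mathcal D_i$. A bi-parameter faithful Haar system relative to $(m_i)$, $(n_j)$ is $\tilde H\otimes\tilde K=(\tilde h_I\otimes\tilde k_J)_{I,J\in\mathcal D}$, where $\tilde H=(\tilde h_I)$, $\tilde K=(\tilde k_J)$ are faithful Haar systems relative to $(m_i)$ and $(n_j)$ respectively. For such a system let, for $f\in\mathcal V(\delta^2)$, $$Af=\sum_{I,J}\frac{\langle\tilde h_I\otimes\tilde k_J,f\rangle}{|I||J|}h_I\otimes k_J,\qquad Bf=\sum_{I,J}\frac{\langle h_I\otimes k_J,f\rangle}{|I||J|}\tilde h_I\otimes\tilde k_J,\qquad D|_{\tilde H\otimes\tilde K}=ADB,$$ which is again a Haar multiplier on $\mathcal V(\delta^2)$. *)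

(* Defs.v *)
From HB Require Import structures.
From mathcomp Require Import all_boot all_order all_algebra.
From mathcomp Require Import finmap.
From mathcomp Require Import all_classical all_reals all_analysis.

Set Implicit Arguments.
Unset Strict Implicit.
Unset Printing Implicit Defensive.

Import Order.TTheory GRing.Theory Num.Theory.
Import numFieldNormedType.Exports.

Local Open Scope classical_set_scope.
Local Open Scope ring_scope.

(* The linear span of a family e of vectors, as a type with its canonical
   structure of submodule. *)
Definition spanning (K : pzRingType) (V : lmodType K) (T : Type) (e : T -> V) :
    {pred V} :=
  [pred f | `[< exists s : seq (K * T), f = \sum_(p <- s) p.1 *: e p.2 >]].

Lemma spanning_submod (K : pzRingType) (V : lmodType K) (T : Type)
  (e : T -> V) : submod_closed (spanning e).
Proof.
split; first by apply/asboolP; exists [::]; rewrite big_nil.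
move=> a f g /asboolP[s ->] /asboolP[t ->]; apply/asboolP.
exists ([seq (a * p.1, p.2) | p <- s] ++ t).
rewrite big_cat big_map scaler_sumr /=; congr (_ + _).
by apply: eq_bigr => p _; rewrite scalerA.
Qed.

HB.instance Definition _ (K : pzRingType) (V : lmodType K) (T : Type)
    (e : T -> V) :=
  GRing.isSubmodClosed.Build K V (spanning e) (spanning_submod e).

Lemma spanning_gen (K : pzRingType) (V : lmodType K) (T : Type) (e : T -> V)
  (x : T) : e x \in spanning e.
Proof. by apply/asboolP; exists [:: (1, x)]; rewrite big_seq1 scale1r. Qed.

Record span (K : pzRingType) (V : lmodType K) (T : Type) (e : T -> V) :=
  Span { span_val :> V ; span_valP : span_val \in spanning e }.

HB.instance Definition _ (K : pzRingType) (V : lmodType K) (T : Type)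
  (e : T -> V) := [isSub for @span_val K V T e].
HB.instance Definition _ (K : pzRingType) (V : lmodType K) (T : Type)
  (e : T -> V) := [Choice of span e by <:].
HB.instance Definition _ (K : pzRingType) (V : lmodType K) (T : Type)
  (e : T -> V) := [SubChoice_isSubLmodule of span e by <:].

(* The dyadic interval [i / 2^j, (i + 1) / 2^j) is encoded by the pair (j, i)
   with i < 2^j, so that the type 'I_(2 ^ j) plays the role of D_j. *)
Definition dyadic : Type := {j : nat & 'I_(2 ^ j)}.
HB.instance Definition _ := Choice.on dyadic.

Definition dy (j : nat) (i : 'I_(2 ^ j)) : dyadic :=
  Tagged (fun j => 'I_(2 ^ j)) i.
Definition level (I : dyadic) : nat := tag I.
Definition position (I : dyadic) : nat := tagged I.

Definition unit_interval : dyadic := dy (ord0 : 'I_(2 ^ 0)).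

Lemma child_subproof (I : dyadic) (w : bool) :
  ((position I).*2 + ~~ w < 2 ^ (level I).+1)%N.
Proof.
case: I => j i; rewrite /position /level /= expnS mul2n.
apply: (@leq_trans ((i : nat).+1).*2); last by rewrite leq_double.
by rewrite doubleS ltnS -[X in (_ <= X)%N]addn1 leq_add2l leq_b1.
Qed.

(* The sign +1 is encoded by true, -1 by false: child I true = I^+ is the left
   half of I and child I false = I^- the right half. *)
Definition child (I : dyadic) (w : bool) : dyadic :=
  dy (Ordinal (child_subproof I w)).

Definition interval_of (R : realType) (I : dyadic) : set R :=
  [set s | (position I)%:R / 2 ^+ level I <= s
           < (position I).+1%:R / 2 ^+ level I].
Arguments interval_of : clear implicits.

Definition len (R : realType) (I : dyadic) : R := 2 ^- level I.

(* Functions on [0,1) are represented by functions on R that vanish outside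
   [0,1), and likewise functions on [0,1)^2. *)
Definition haar_fun (R : realType) (I : dyadic) : R -> R :=
  fun s => \1_(interval_of R (child I true)) s
           - \1_(interval_of R (child I false)) s.
Arguments haar_fun : clear implicits.

Definition tensor_fun (R : realType) (f g : R -> R) : R * R -> R :=
  fun p => f p.1 * g p.2.

Definition haar2_fun (R : realType) (p : dyadic * dyadic) : R * R -> R :=
  tensor_fun (haar_fun R p.1) (haar_fun R p.2).
Arguments haar2_fun : clear implicits.

Definition V1 (R : realType) : lmodType R := span (haar_fun R).
Definition V2 (R : realType) : lmodType R := span (haar2_fun R).

Definition haar (R : realType) (I : dyadic) : V1 R :=
  Span (spanning_gen (haar_fun R) I).

Lemma tensor_spanning (R : realType) (f g : V1 R) :
  tensor_fun (val f) (val g) \in spanning (haar2_fun R).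
Proof.
case: f g => f /= /asboolP[s ->] [g /= /asboolP[t ->]]; apply/asboolP.
exists [seq (p.1 * q.1, (p.2, q.2)) | p <- s, q <- t].
apply/funext => -[x y]; rewrite /tensor_fun !fct_sumE /=.
rewrite big_distrlr /= big_allpairs_dep /=.
apply: eq_bigr => p _; apply: eq_bigr => q _.
by rewrite /haar2_fun /tensor_fun /= mulrACA.
Qed.

Definition tensor (R : realType) (f g : V1 R) : V2 R :=
  Span (tensor_spanning f g).

Definition haar2 (R : realType) (I J : dyadic) : V2 R :=
  tensor (haar R I) (haar R J).

Definition inner (R : realType) (f g : V2 R) : R :=
  \int[lebesgue_measure]_(t in `[0, 1[)
    \int[lebesgue_measure]_(s in `[0, 1[) (val f (s, t) * val g (s, t)).

Definition is_haar_multiplier (R : realType) (D : {linear V2 R -> V2 R}) :=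
  forall I J : dyadic, exists d : R, D (haar2 R I J) = d *: haar2 R I J.

(* d_{I,J}: the scalar by which D acts on h_I (x) k_J; it is unique since
   h_I (x) k_J is nonzero. *)
Definition entry (R : realType) (D : V2 R -> V2 R) (I J : dyadic) : R :=
  xget 0 [set d : R | D (haar2 R I J) = d *: haar2 R I J].

Definition linfty_norm (R : realType) (D : V2 R -> V2 R) : \bar R :=
  ereal_sup [set `|entry D p.1 p.2|%:E | p in [set: dyadic * dyadic]].

(* The sums over pairs of dyadic intervals below have only finitely many
   nonzero terms because f is a finite linear combination of Haar functions. *)
Definition haar_multiplier (R : realType) (d : dyadic -> dyadic -> R)
    (f : V2 R) : V2 R :=
  \sum_(p \in [set: dyadic * dyadic])
    (d p.1 p.2 * inner (haar2 R p.1 p.2) f / (len R p.1 * len R p.2))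
      *: haar2 R p.1 p.2.

Definition capon (R : realType) : V2 R -> V2 R :=
  haar_multiplier (fun I J => (len R I <= len R J)%R%:R).

Definition block_mean (R : realType) (D : V2 R -> V2 R) (i j : nat) : R :=
  \sum_(I : 'I_(2 ^ i)) \sum_(J : 'I_(2 ^ j))
    len R (dy I) * len R (dy J) * entry D (dy I) (dy J).

Definition lambda (R : realType) (U : set_system nat) (D : V2 R -> V2 R) : R :=
  lim (lim (block_mean D i j @[i --> U]) @[j --> U]).

Definition mu (R : realType) (U : set_system nat) (D : V2 R -> V2 R) : R :=
  lim (lim (block_mean D i j @[j --> U]) @[i --> U]).

(* Maxima of nonnegative quantities over nonempty finite index sets, so that
   the default value 0 is harmless. *)
Definition max_sign (R : realType) (F : bool -> R) : R :=
  \big[Num.max/0]_(w : bool) F w.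

Definition max_level (R : realType) (i j : nat) (F : dyadic -> dyadic -> R) :
    R :=
  \big[Num.max/0]_(I : 'I_(2 ^ i)) \big[Num.max/0]_(J : 'I_(2 ^ j))
    F (dy I) (dy J).

Definition T2S_norm (R : realType) (D : V2 R -> V2 R) : \bar R :=
  let d := entry D in
  (\sum_(0 <= k <oo) (k.+1%:R * max_level k k (fun I J =>
      max_sign (fun w => max_sign (fun x =>
        `|d I J - d (child I w) (child J x)|))))%:E
   + \sum_(0 <= k <oo) (k.+1%:R * max_level k k.+1 (fun I J =>
      max_sign (fun w => max_sign (fun x =>
        `|d I J - d (child I w) (child J x)|))))%:E
   + \sum_(0 <= i <oo) (\sum_(0 <= j < i.+1) max_level i j (fun I J =>
      max_sign (fun w => `|d I J - d (child I w) J|)))%:E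
   + \sum_(0 <= j <oo) (\sum_(0 <= i < j.+1) max_level i j.+1 (fun I J =>
      max_sign (fun x => `|d I J - d I (child J x)|)))%:E)%E.

Definition T2_norm (R : realType) (D : V2 R -> V2 R) : \bar R :=
  (T2S_norm D
   + `|entry D unit_interval unit_interval|%:E
   + `|entry D unit_interval (child unit_interval true)|%:E
   + `|entry D unit_interval (child unit_interval false)|%:E)%E.

Definition support_of (R : realType) (A : {fset dyadic}) : set R :=
  \bigcup_(K in [set` A]) interval_of R K.
Arguments support_of : clear implicits.

Definition faithful_haar_system (R : realType) (ht : dyadic -> V1 R)
    (A : dyadic -> {fset dyadic}) : Prop :=
  [/\ forall I, {in A I &, forall K L, K != L ->
        interval_of R K `&` interval_of R L = set0},
      forall I, exists eps : dyadic -> bool,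
        ht I = \sum_(K <- A I) (-1) ^+ eps K *: haar R K,
      support_of R (A unit_interval) = `[0, 1[%classic,
      forall I, support_of R (A (child I true)) = [set s | val (ht I) s = 1] &
      forall I, support_of R (A (child I false)) = [set s | val (ht I) s = -1]].

Definition faithful_haar_system_rel (R : realType) (ht : dyadic -> V1 R)
    (m : nat -> nat) : Prop :=
  {homo m : i j / (i < j)%N} /\
  exists A : dyadic -> {fset dyadic}, faithful_haar_system ht A /\
    forall I K, K \in A I -> level K = m (level I).

Definition opA (R : realType) (ht kt : dyadic -> V1 R) (f : V2 R) : V2 R :=
  \sum_(p \in [set: dyadic * dyadic])
    (inner (tensor (ht p.1) (kt p.2)) f / (len R p.1 * len R p.2))
      *: haar2 R p.1 p.2.

Definition opB (R : realType) (ht kt : dyadic -> V1 R) (f : V2 R) : V2 R :=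
  \sum_(p \in [set: dyadic * dyadic])
    (inner (haar2 R p.1 p.2) f / (len R p.1 * len R p.2))
      *: tensor (ht p.1) (kt p.2).

Definition restriction (R : realType) (D : V2 R -> V2 R)
    (ht kt : dyadic -> V1 R) : V2 R -> V2 R :=
  opA ht kt \o D \o opB ht kt.

(* Main.v *)
(** Take all signs equal to +1: the system with frequencies [m] is
    [ht I = \sum_K h_K], over the [K] of level [m (level I)] whose binary digits
    at the places [m 0 < m 1 < ...] are the digits of [I].  The coefficient of
    the restricted multiplier at [(I, J)] is then the mean over the squares
    [K x L] of levels [m i], [n j] of [d_{K,L}], weighted by the products of the
    densities [1 +- r_{m l}(K)], [l < i], and [1 +- r_{n l}(L)], [l < j], where
    [r_q] are the Rademacher functions.

    For a fixed bounded weight [g], the weighted means of [D] have iterated limits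
    along [U]; for [g = 1] these are [lambda U D] and [mu U D].  Bessel's
    inequality passes to these limits, so the limit functionals tend to 0 on
    [g * r_q] as [q -> oo].  Passing from [I] to a child [I^w] multiplies the
    weight by [1 +- r_{m i}], hence choosing [n 0, m 0, n 1, m 1, ...] successively
    sufficiently far along [U] makes all the variations summable and small. *)

Require Import Defs.
From HB Require Import structures.
From mathcomp Require Import all_boot all_order all_algebra.
From mathcomp Require Import finmap.
From mathcomp Require Import all_classical all_reals all_analysis.
From mathcomp Require Import zify ring lra.

Set Implicit Arguments.
Unset Strict Implicit.
Unset Printing Implicit Defensive.

Import Order.TTheory GRing.Theory Num.Theory.
Import numFieldNormedType.Exports.

Local Open Scope classical_set_scope.
Local Open Scope ring_scope.

(** * Binary digits of dyadic intervals and of points *)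

(* Digit 0 stands for the left half [I^+], digit 1 for the right half [I^-]. *)
Definition bits (I : dyadic) (q : nat) : bool :=
  odd (position I %/ 2 ^ (level I - q.+1)).

Lemma dyadic_eq (I J : dyadic) :
  level I = level J -> position I = position J -> I = J.
Proof.
case: I J => [i k] [j l]; rewrite /level /position /= => e; subst j => kl.
by congr Tagged; apply: val_inj.
Qed.

Lemma dyE (I : dyadic) : I = dy (tagged I). Proof. by case: I. Qed.

Lemma position_child I w : position (child I w) = ((position I).*2 + ~~ w)%N.
Proof. by []. Qed.

Lemma child_double_half (p : nat) (w : bool) : ((p.*2 + ~~ w)./2 = p)%N.
Proof. by rewrite addnC; case: w; rewrite /= ?add0n ?doubleK ?uphalf_double. Qed.

Lemma bits_child_lt I w q : (q < level I)%N -> bits (child I w) q = bits I q.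
Proof.
move=> qI; rewrite /bits position_child /= /level /= -/(level I).
have -> : ((level I).+1 - q.+1 = (level I - q.+1).+1)%N by rewrite subSn.
by rewrite expnS divnMA divn2 child_double_half.
Qed.

Lemma bits_child_level I w : bits (child I w) (level I) = ~~ w.
Proof.
by rewrite /bits position_child /level /= subnn expn0 divn1 oddD odd_double; case: w.
Qed.

Lemma parent (I : dyadic) (i : nat) : level I = i.+1 ->
  exists J w, level J = i /\ I = child J w.
Proof.
case: I => l k; rewrite /level /= => e; subst l.
have hk : (k./2 < 2 ^ i)%N.
  by rewrite ltn_half_double -mul2n -expnS.
exists (dy (Ordinal hk)), (~~ odd k); split => //.
apply: dyadic_eq; rewrite ?position_child // negbK /position /=.
by rewrite addnC odd_double_half.
Qed.

Lemma level_dy i (k : 'I_(2 ^ i)) : level (dy k) = i. Proof. by []. Qed.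

Lemma sum_dyadicS (V : nmodType) (i : nat) (F : dyadic -> V) :
  \sum_(I : 'I_(2 ^ i.+1)) F (dy I) =
  \sum_(I : 'I_(2 ^ i)) \sum_(w : bool) F (child (dy I) w).
Proof.
rewrite pair_big /=.
rewrite (reindex (fun p : 'I_(2 ^ i) * bool =>
  (Ordinal (child_subproof (dy p.1) p.2) : 'I_(2 ^ i.+1)))) //=.
have hk (k : 'I_(2 ^ i.+1)) : (k./2 < 2 ^ i)%N by rewrite ltn_half_double -mul2n -expnS.
apply: onW_bij; exists (fun k => (Ordinal (hk k), ~~ odd k)).
  move=> [k w]; congr pair; last by rewrite /= oddD odd_double /=; case: w.
  by apply: val_inj; rewrite /= child_double_half.
by move=> k; apply: val_inj; rewrite /= negbK addnC odd_double_half.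
Qed.

Section Points.
Variable R : realType.
Implicit Types (s : R) (I J K : dyadic).

(** For [s >= 0] this is the index of the interval of length $2^{-q}$ containing [s], and [sbit s q]
    is the binary digit whose sign is the Rademacher function $r_q(s)$. Since [Num.truncn] sends
    negative reals to 0, [dmem] has to carry the condition [0 <= s] itself. *)
Definition pos_at s (q : nat) : nat := Num.truncn (2 ^+ q * s).
Definition sbit s (q : nat) : bool := odd (pos_at s q.+1).
Definition dmem I s : bool := (0 <= s) && (pos_at s (level I) == position I).

Lemma interval_ofE I s : interval_of R I s <-> dmem I s.
Proof.
rewrite /interval_of /dmem /pos_at /=.
have h2 : (0 : R) < 2 ^+ level I by rewrite exprn_gt0.
rewrite ler_pdivrMr // ltr_pdivlMr // mulrC.
split => [h|/andP[s0 /eqP <-]]; last by apply: truncn_itv; rewrite mulr_ge0 // ltW.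
have s0 : 0 <= s.
  rewrite -(pmulr_rge0 _ h2); case/andP: h => h _; apply: le_trans h.
  exact: ler0n.
by rewrite s0 /=; apply/eqP/truncn_def.
Qed.

Lemma truncn_half s : 0 <= s -> (Num.truncn (2 * s))./2 = Num.truncn s.
Proof.
move=> s0; have /andP[h1 h2] := truncn_itv s0.
have s20 : 0 <= 2 * s by rewrite mulr_ge0.
have l1 : ((Num.truncn s).*2 <= Num.truncn (2 * s))%N.
  by rewrite truncn_ge_nat // -mul2n natrM ler_pM2l.
have l2 : (Num.truncn (2 * s) < (Num.truncn s).+1.*2)%N.
  rewrite -(ltr_nat R) -mul2n natrM; apply: le_lt_trans (_ : 2 * s < _).
    by case/andP: (truncn_itv s20).
  by rewrite ltr_pM2l.
lia.
Qed.

Lemma pos_atS s q : 0 <= s -> (pos_at s q.+1)./2 = pos_at s q.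
Proof.
by move=> s0; rewrite /pos_at exprS -mulrA truncn_half // mulr_ge0 // exprn_ge0.
Qed.

Lemma pos_atD s q k : 0 <= s -> (pos_at s (q + k) %/ 2 ^ k)%N = pos_at s q.
Proof.
move=> s0; elim: k => [|k IH]; first by rewrite addn0 divn1.
by rewrite expnS divnMA divn2 addnS pos_atS.
Qed.

Lemma dmem_bits I s q : dmem I s -> (q < level I)%N -> bits I q = sbit s q.
Proof.
move=> /andP[s0 /eqP e] qI; rewrite /bits -e /sbit.
by rewrite -(pos_atD q.+1 (level I - q.+1)%N s0) subnKC.
Qed.

Lemma dmem_child I w s :
  dmem (child I w) s = dmem I s && (sbit s (level I) == ~~ w).
Proof.
rewrite /dmem /sbit position_child /level /= -/(level I).
case: (boolP (0 <= s)) => //= s0.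
rewrite -(pos_atS (level I) s0).
apply/eqP/andP => [->|[/eqP <- /eqP <-]]; last by rewrite addnC odd_double_half.
by rewrite child_double_half oddD odd_double /= oddb !eqxx.
Qed.

Lemma dmem_inj I J s : level I = level J -> dmem I s -> dmem J s -> I = J.
Proof.
move=> e /andP[_ /eqP p1] /andP[_ /eqP p2]; apply: dyadic_eq => //.
by rewrite -p1 -p2 e.
Qed.

(** Nestedness of dyadic intervals: by [pos_atD] the index of a point at a level determines its
    index at every coarser level. *)
Lemma dmem_nested I K s t :
  (level I <= level K)%N -> dmem K s -> dmem K t -> dmem I s = dmem I t.
Proof.
move=> IK /andP[s0 /eqP ps] /andP[t0 /eqP pt].
rewrite /dmem s0 t0 /= -(pos_atD (level I) (level K - level I)%N s0).
by rewrite -(pos_atD (level I) (level K - level I)%N t0) subnKC // ps pt.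
Qed.

Lemma dmem01 I s : dmem I s -> 0 <= s < 1.
Proof.
move=> /andP[s0 /eqP e]; rewrite s0 /=.
have h2 : (0 : R) < 2 ^+ level I by rewrite exprn_gt0.
rewrite -(ltr_pM2l h2) mulr1; have /andP[_] := truncn_itv (mulr_ge0 (ltW h2) s0).
rewrite -/(pos_at s _) e => /lt_le_trans; apply.
by rewrite -natrX ler_nat ltn_ord.
Qed.

Lemma dmem_ex (q : nat) s : 0 <= s < 1 -> exists K, level K = q /\ dmem K s.
Proof.
move=> /andP[s0 s1]; have h2 : (0 : R) < 2 ^+ q by rewrite exprn_gt0.
have h : (pos_at s q < 2 ^ q)%N.
  rewrite -(ltr_nat R) natrX; apply: le_lt_trans (_ : 2 ^+ q * s < _).
    by case/andP: (truncn_itv (mulr_ge0 (ltW h2) s0)).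
  by rewrite -[ltRHS]mulr1 ltr_pM2l.
by exists (dy (Ordinal h)); split => //; rewrite /dmem s0 /= /position /level /=.
Qed.

Lemma dmem_left I : dmem I ((position I)%:R / 2 ^+ level I : R).
Proof.
have h2 : (0 : R) < 2 ^+ level I by rewrite exprn_gt0.
apply/interval_ofE; rewrite /interval_of /= lexx /= ltr_pM2r ?invr_gt0 //.
by rewrite ltr_nat.
Qed.

Lemma haar_funE I s : haar_fun R I s = (dmem I s)%:R * (-1) ^+ sbit s (level I).
Proof.
have h w : \1_(interval_of R (child I w)) s = (dmem (child I w) s)%:R :> R.
  rewrite indicE; congr (nat_of_bool _)%:R; apply/idP/idP.
    by rewrite inE => /interval_ofE.
  by move=> /interval_ofE; rewrite inE.
rewrite /haar_fun !h !dmem_child; case: (dmem I s); case: (sbit s _) => //=.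
- by rewrite mul1r expr1 sub0r.
- by rewrite mul1r expr0 subr0.
- by rewrite mul0r subr0.
- by rewrite mul0r subr0.
Qed.

End Points.

(** * Orthogonality of the Haar functions *)

Section HaarIntegrals.
Variable R : realType.
Implicit Types (I J K : dyadic).
Local Notation leb := (@lebesgue_measure R).
Local Notation U01 := (`[0, 1[%classic : set R).

Lemma interval_of_itv I : interval_of R I =
  [set` `[(position I)%:R / 2 ^+ level I, (position I).+1%:R / 2 ^+ level I[%R].
Proof. by apply/seteqP; split => x /=; rewrite in_itv. Qed.

Lemma measurable_interval_of I : measurable (interval_of R I).
Proof. by rewrite interval_of_itv; exact: measurable_itv. Qed.

Lemma interval_of_sub I : interval_of R I `<=` U01.
Proof. by move=> s /interval_ofE /dmem01 /=; rewrite in_itv. Qed.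

Lemma lebesgue_interval_of I : leb (interval_of R I) = (len R I)%:E.
Proof.
have h2 : (0 : R) < 2 ^+ level I by rewrite exprn_gt0.
rewrite interval_of_itv lebesgue_measure_itv /= lte_fin ltr_pM2r ?invr_gt0 //.
rewrite ltr_nat ltnSn -EFinB; congr _%:E.
by rewrite -mulrBl -natrB // subSnn mul1r.
Qed.

Lemma integrable_interval_of I :
  leb.-integrable U01 (EFin \o (\1_(interval_of R I) : R -> R)).
Proof.
apply: (integrableS measurableT) => //.
by rewrite interval_of_itv; exact: integrable_indic_itv.
Qed.

Lemma Rintegral_interval_of I :
  \int[leb]_(s in U01) (\1_(interval_of R I) s) = len R I.
Proof.
rewrite /Rintegral integral_indic //; last exact: measurable_interval_of.
rewrite (setIidl (@interval_of_sub I)).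
exact: (congr1 fine (lebesgue_interval_of I)).
Qed.

Lemma integrable_haar I : leb.-integrable U01 (EFin \o haar_fun R I).
Proof.
apply: eq_integrable (integrableB _ (integrable_interval_of (child I true))
  (integrable_interval_of (child I false))) => //.
Qed.

Lemma len_child I w : len R (child I w) = len R I / 2.
Proof. by rewrite /len /level /= exprS invfM mulrC. Qed.

Lemma Rintegral_haar I : \int[leb]_(s in U01) (haar_fun R I s) = 0.
Proof.
rewrite RintegralB //; try exact: integrable_interval_of.
by rewrite !Rintegral_interval_of !len_child subrr.
Qed.

(** The coarser Haar function is constant on the support of the finer one; the constant is its value
    at the left endpoint of [J]. *)
Lemma haar_mul_lt I J : (level I < level J)%N ->
  exists c : R, forall s, haar_fun R I s * haar_fun R J s = c * haar_fun R J s.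
Proof.
move=> IJ; pose t : R := (position J)%:R / 2 ^+ level J.
have mt : dmem J t := dmem_left R J.
exists (haar_fun R I t) => s.
rewrite [haar_fun R J s]haar_funE; case: (boolP (dmem J s)) => [ms|_]; last first.
  by rewrite mul0r !mulr0.
congr (_ * _); rewrite !haar_funE (dmem_nested (ltnW IJ) ms mt).
by rewrite -(dmem_bits ms IJ) (dmem_bits mt IJ).
Qed.

Lemma haar_mul_diag I s :
  haar_fun R I s * haar_fun R I s = \1_(interval_of R I) s.
Proof.
rewrite haar_funE mulrACA -!expr2 sqrr_sign mulr1 indicE.
have -> : (s \in interval_of R I) = dmem I s.
  by apply/idP/idP; [rewrite inE => /interval_ofE|move/interval_ofE; rewrite inE].
by case: (dmem I s); rewrite ?expr1n ?expr0n.
Qed.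

Lemma haar_mul_off I J s : level I = level J -> I != J ->
  haar_fun R I s * haar_fun R J s = 0.
Proof.
move=> e /eqP IJ; rewrite !haar_funE.
case: (boolP (dmem I s)) => [mI|_]; last by rewrite !mul0r.
case: (boolP (dmem J s)) => [mJ|_]; last by rewrite !mul0r mulr0.
by case: IJ; exact: dmem_inj mI mJ.
Qed.

(** Integrability and integral of a product are packaged with one function [f], so that [inner_sum]
    can pick such an [f] for all pairs at once by choice. *)
Lemma haar_mul I J : exists f : R -> R,
  [/\ forall s, haar_fun R I s * haar_fun R J s = f s,
      leb.-integrable U01 (EFin \o f) &
      \int[leb]_(s in U01) f s = (I == J)%:R * len R I].
Proof.
have lt_case I' J' : (level I' < level J')%N -> exists f : R -> R,
  [/\ forall s, haar_fun R I' s * haar_fun R J' s = f s,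
      leb.-integrable U01 (EFin \o f) &
      \int[leb]_(s in U01) f s = 0].
  move=> /haar_mul_lt[c hc]; exists (fun s => c * haar_fun R J' s); split => //.
    have -> : EFin \o (fun s => c * haar_fun R J' s) =
      (fun s => c%:E * (EFin \o haar_fun R J') s)%E.
      by apply/funext => s /=; rewrite EFinM.
    by apply: integrableZl => //; exact: integrable_haar.
  by rewrite RintegralZl ?Rintegral_haar ?mulr0 //; exact: integrable_haar.
case: (ltngtP (level I) (level J)) => [h|h|h].
- have [f [f1 f2 f3]] := lt_case _ _ h; exists f; split => //; rewrite f3.
  by case: eqP h => [->|_]; rewrite ?ltnn ?mul0r.
- have [f [f1 f2 f3]] := lt_case _ _ h; exists f; split => //; last rewrite f3.
    by move=> s; rewrite mulrC f1.
  by case: eqP h => [->|_]; rewrite ?ltnn ?mul0r.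
- case: (eqVneq I J) => [<-|IJ].
    exists (\1_(interval_of R I)); split; [exact: haar_mul_diag| |].
      exact: integrable_interval_of.
    by rewrite Rintegral_interval_of mul1r.
  exists (fun=> 0); split; [by move=> s; exact: haar_mul_off| |].
    exact: integrable0.
  by rewrite Rintegral_cst // !mul0r.
Qed.

Lemma Rintegral_sum (T : Type) (r : seq T) (F : T -> R -> R) :
  (forall x, leb.-integrable U01 (EFin \o F x)) ->
  leb.-integrable U01 (EFin \o (fun s => \sum_(x <- r) F x s)) /\
  \int[leb]_(s in U01) (\sum_(x <- r) F x s) =
  \sum_(x <- r) \int[leb]_(s in U01) F x s.
Proof.
move=> iF; elim: r => [|x r [IH1 IH2]].
  have -> : (fun s => \sum_(x <- [::]) F x s) = fun=> 0.
    by apply/funext => s; rewrite big_nil.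
  by split; [exact: integrable0|rewrite Rintegral_cst // mul0r big_nil].
have -> : (fun s => \sum_(y <- x :: r) F y s) = (fun s => F x s + \sum_(y <- r) F y s).
  by apply/funext => s; rewrite big_cons.
split; last by rewrite big_cons RintegralD // IH2.
by apply: eq_integrable (integrableD _ (iF x) IH1).
Qed.

Lemma integrable_scale (c : R) (f : R -> R) : leb.-integrable U01 (EFin \o f) ->
  leb.-integrable U01 (EFin \o (fun s => c * f s)).
Proof.
move=> hf; have -> : EFin \o (fun s => c * f s) = (fun s => c%:E * (EFin \o f) s)%E.
  by apply/funext => s /=; rewrite EFinM.
exact: integrableZl.
Qed.

(** The product of the two expansions is a finite sum of functions with separated variables, so the
    iterated integral factors term by term into one-variable integrals, given by [haar_mul]. *)
Lemma inner_sum (T T' : Type) (r : seq T) (r' : seq T') (c : T -> R) (c' : T' -> R)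
    (p : T -> dyadic * dyadic) (p' : T' -> dyadic * dyadic) (f g : V2 R) :
  val f = \sum_(x <- r) c x *: haar2_fun R (p x) ->
  val g = \sum_(y <- r') c' y *: haar2_fun R (p' y) ->
  inner f g = \sum_(x <- r) \sum_(y <- r')
    c x * c' y * ((p x == p' y)%:R * (len R (p x).1 * len R (p x).2)).
Proof.
move=> ef eg.
have [k hk] := choice (fun q : dyadic * dyadic => haar_mul q.1 q.2).
pose rr := [seq (x, y) | x <- r, y <- r'].
pose k1 (z : T * T') := k ((p z.1).1, (p' z.2).1).
pose k2 (z : T * T') := k ((p z.1).2, (p' z.2).2).
have i1 z : leb.-integrable U01 (EFin \o k1 z) by case: (hk ((p z.1).1, (p' z.2).1)).
have i2 z : leb.-integrable U01 (EFin \o k2 z) by case: (hk ((p z.1).2, (p' z.2).2)).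
have e s t : val f (s, t) * val g (s, t) =
    \sum_(z <- rr) (c z.1 * c' z.2 * k2 z t) * k1 z s.
  rewrite ef eg !fct_sumE big_distrlr /= big_allpairs_dep /=.
  apply: eq_bigr => x _; apply: eq_bigr => y _ /=.
  have [h1 _ _] := hk ((p x).1, (p' y).1); have [h2 _ _] := hk ((p x).2, (p' y).2).
  rewrite /k1 /k2 /= -h1 -h2 /= /haar2_fun /tensor_fun /=.
  rewrite -[LHS]/(c x * (haar_fun R (p x).1 s * haar_fun R (p x).2 t) *
    (c' y * (haar_fun R (p' y).1 s * haar_fun R (p' y).2 t))).
  by ring.
rewrite /inner.
under eq_Rintegral do under eq_Rintegral do rewrite e.
transitivity (\int[leb]_(t in U01) \sum_(z <- rr)
    (c z.1 * c' z.2 * \int[leb]_(s in U01) k1 z s) * k2 z t).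
  apply: eq_Rintegral => t _.
  rewrite (Rintegral_sum rr _).2; last by move=> z; exact: integrable_scale.
  by apply: eq_bigr => z _; rewrite RintegralZl // mulrAC.
rewrite (Rintegral_sum rr _).2; last by move=> z; exact: integrable_scale.
rewrite big_allpairs_dep /=; apply: eq_bigr => x _; apply: eq_bigr => y _ /=.
rewrite RintegralZl //.
have [_ _ h1] := hk ((p x).1, (p' y).1); have [_ _ h2] := hk ((p x).2, (p' y).2).
rewrite /k1 /k2 /= h1 h2 /= -!mulrA; congr (_ * (_ * _)).
case: (p x) (p' y) => a b [a' b'] /=; rewrite xpair_eqE.
by case: (a == a'); case: (b == b'); rewrite /= ?(mul0r, mul1r, mulr0).
Qed.

End HaarIntegrals.

(** * Coefficients of multipliers and of their restrictions *)

Section Restriction.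
Variable R : realType.
Implicit Types (I J K L : dyadic).

Lemma haar2_neq0 I J : haar2 R I J != 0.
Proof.
apply/eqP => /(congr1 val) /= /(congr1 (fun f => f ((position I)%:R / 2 ^+ level I,
  (position J)%:R / 2 ^+ level J))) /= /eqP.
rewrite /tensor_fun /= !haar_funE !dmem_left !mul1r -signr_addb.
by apply/negP; rewrite signr_eq0.
Qed.

Lemma entry_eq (D : V2 R -> V2 R) I J (d : R) :
  D (haar2 R I J) = d *: haar2 R I J -> entry D I J = d.
Proof.
move=> h; rewrite /entry; set A := [set e | _].
have : A (xget 0 A) by apply: (@xgetI _ _ _ d).
rewrite /A /= h => /eqP; rewrite -subr_eq0 -scalerBl scaler_eq0.
by rewrite (negbTE (haar2_neq0 I J)) orbF subr_eq0 => /eqP.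
Qed.

Lemma entryE (D : {linear V2 R -> V2 R}) : is_haar_multiplier D ->
  forall I J, D (haar2 R I J) = entry D I J *: haar2 R I J.
Proof. by move=> hD I J; have [d hd] := hD I J; rewrite (entry_eq hd). Qed.

Lemma inner_haar2 (p q : dyadic * dyadic) : inner (haar2 R p.1 p.2) (haar2 R q.1 q.2) =
  (p == q)%:R * (len R p.1 * len R p.2).
Proof.
rewrite (@inner_sum R _ _ [:: p] [:: q] (fun=> 1) (fun=> 1) id id).
- by rewrite !big_seq1 !mul1r.
- by rewrite big_seq1 scale1r.
- by rewrite big_seq1 scale1r.
Qed.

Lemma len_neq0 I : len R I != 0.
Proof. by rewrite /len invr_eq0 expf_neq0. Qed.

Lemma fsbig_single (T : choiceType) (V : nmodType) (q : T) (F : T -> V) :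
  (forall p, p != q -> F p = 0) -> \sum_(p \in [set: T]) F p = F q.
Proof.
move=> h; rewrite (@fsbigTE _ _ _ _ [fset q]%fset) ?big_seq_fset1 // => p.
by rewrite inE => /h.
Qed.

(** Orthogonality leaves a single term of the sums that define [haar_multiplier] and [opB]. This
    also shows that their support is finite, without which the sum would take its default value
    0. *)
Lemma coef_haar2 (V : lmodType R) (c : dyadic * dyadic -> R) (F : dyadic * dyadic -> V)
    (q : dyadic * dyadic) :
  \sum_(p \in [set: dyadic * dyadic])
    (c p * inner (haar2 R p.1 p.2) (haar2 R q.1 q.2) / (len R p.1 * len R p.2)) *: F p =
  c q *: F q.
Proof.
rewrite (@fsbig_single _ _ q); last first.
  by move=> p pq; rewrite inner_haar2 (negbTE pq) mul0r mulr0 mul0r scale0r.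
rewrite inner_haar2 eqxx mul1r mulfK //.
by rewrite mulf_neq0 // len_neq0.
Qed.

Lemma haar_multiplierE (d : dyadic -> dyadic -> R) I J :
  haar_multiplier d (haar2 R I J) = d I J *: haar2 R I J.
Proof.
exact: (coef_haar2 (fun p => d p.1 p.2) (fun p => haar2 R p.1 p.2) (I, J)).
Qed.

Lemma opB_haar2 (ht kt : dyadic -> V1 R) I J :
  opB ht kt (haar2 R I J) = tensor (ht I) (kt J).
Proof.
rewrite /opB -[RHS]scale1r.
rewrite -(coef_haar2 (fun=> 1) (fun p => tensor (ht p.1) (kt p.2)) (I, J)).
by apply: eq_fsbigr => p _; rewrite mul1r.
Qed.

Lemma val_tensor (f g : V1 R) : val (tensor f g) = tensor_fun (val f) (val g).
Proof. by []. Qed.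

Lemma val_haar_sum (r : seq dyadic) s :
  val (\sum_(K <- r) haar R K) s = \sum_(K <- r) haar_fun R K s.
Proof. by rewrite raddf_sum fct_sumE. Qed.

Lemma tensor_sum (r r' : seq dyadic) :
  tensor (\sum_(K <- r) haar R K) (\sum_(L <- r') haar R L) =
  \sum_(p <- [seq (K, L) | K <- r, L <- r']) haar2 R p.1 p.2.
Proof.
apply: val_inj; rewrite raddf_sum val_tensor big_allpairs_dep.
apply/funext => -[s t]; rewrite /tensor_fun !val_haar_sum !fct_sumE big_distrlr.
by apply: eq_bigr => K _; rewrite fct_sumE.
Qed.

Lemma sum_delta (T : eqType) (r : seq T) (F : T -> R) x : uniq r ->
  \sum_(y <- r) F y * (x == y)%:R = (x \in r)%:R * F x.
Proof.
move=> ur; case: (boolP (x \in r)) => xr; last first.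
  rewrite mul0r big_seq big1 // => y yr; case: eqP => [xy|]; rewrite ?mulr0 //.
  by rewrite xy yr in xr.
rewrite (bigD1_seq x) //= eqxx mulr1 mul1r big1 ?addr0 // => y.
by rewrite eq_sym => /negbTE ->; rewrite mulr0.
Qed.

Variables (D : {linear V2 R -> V2 R}) (hD : is_haar_multiplier D).
Variables (A B : dyadic -> {fset dyadic}).
Hypothesis A_disj : forall I J K, K \in A I -> K \in A J -> I = J.
Hypothesis B_disj : forall I J K, K \in B I -> K \in B J -> I = J.
Let ht I := \sum_(K <- A I) haar R K.
Let kt J := \sum_(L <- B J) haar R L.

(** The families [A I] share no interval for different [I], and likewise [B J]. Hence $DB(h_I\otimes
    k_J)$ is orthogonal to all $\tilde h_{I'}\otimes\tilde k_{J'}$ with $(I',J')\ne(I,J)$, and only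
    one coefficient of [opA] survives. *)
Lemma restriction_haar2 I J : restriction D ht kt (haar2 R I J) =
  ((\sum_(K <- A I) \sum_(L <- B J) entry D K L * (len R K * len R L)) /
   (len R I * len R J)) *: haar2 R I J.
Proof.
rewrite /restriction /= opB_haar2 /ht /kt tensor_sum linear_sum /=.
pose AB (q : dyadic * dyadic) := [seq (K, L) | K <- A q.1, L <- B q.2].
have uAB q : uniq (AB q).
  by apply: allpairs_uniq; [exact: fset_uniq|exact: fset_uniq|move=> [? ?] [? ?]].
set g := (X in opA _ _ X).
have vg : val g = \sum_(p <- AB (I, J)) entry D p.1 p.2 *: haar2_fun R p.
  rewrite /g raddf_sum; apply: eq_bigr => p _.
  by rewrite entryE // linearZ.
have innerE q : inner (tensor (ht q.1) (kt q.2)) g =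
    (q == (I, J))%:R * \sum_(p <- AB (I, J)) entry D p.1 p.2 * (len R p.1 * len R p.2).
  rewrite (@inner_sum R _ _ (AB q) (AB (I, J)) (fun=> 1)
    (fun p => entry D p.1 p.2) id id _ _ _ vg); last first.
    rewrite tensor_sum raddf_sum; apply: eq_bigr => p _.
    by rewrite scale1r.
  transitivity (\sum_(x <- AB q) (x \in AB (I, J))%:R *
      (entry D x.1 x.2 * (len R x.1 * len R x.2))).
    apply: eq_bigr => x _; rewrite -(@sum_delta _ (AB (I, J))
      (fun p => entry D p.1 p.2 * (len R p.1 * len R p.2)) x (uAB _)).
    apply: eq_bigr => y _.
    by case: eqP => [->|_]; rewrite ?mulr0 ?mul0r ?mulr0 //= !mul1r mulr1.
  case: eqP => [->|/eqP qIJ].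
    by rewrite mul1r; apply: eq_big_seq => x ->; rewrite mul1r.
  rewrite mul0r big_seq big1 // => x xq.
  case: (boolP (x \in AB (I, J))) => xIJ; last by rewrite mul0r.
  case/allpairsP: xq xIJ => -[a b] /= [aA bB ->] /allpairsP[[a' b'] /= [aA' bB' [ea eb]]].
  subst a' b'; case/eqP: qIJ.
  by case: q aA bB => q1 q2 /= aA bB; rewrite (A_disj aA aA') (B_disj bB bB').
rewrite /opA (@fsbig_single _ _ (I, J)); last first.
  by move=> p pIJ; rewrite -/(ht _) -/(kt _) innerE (negbTE pIJ) mul0r mul0r scale0r.
rewrite -/(ht _) -/(kt _) innerE eqxx mul1r /=; congr ((_ / _) *: _).
by rewrite big_allpairs_dep.
Qed.

Lemma entry_restriction I J : entry (restriction D ht kt) I J =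
  (\sum_(K <- A I) \sum_(L <- B J) entry D K L * (len R K * len R L)) /
   (len R I * len R J).
Proof. exact: entry_eq (restriction_haar2 I J). Qed.

Lemma entry_sub_capon (lam mu0 : R) I J :
  entry (restriction D ht kt - (lam *: @capon R + mu0 *: (idfun - @capon R)))%R I J =
  entry (restriction D ht kt) I J -
  (if (level J <= level I)%N then lam else mu0).
Proof.
apply: entry_eq; rewrite entry_restriction.
rewrite -[LHS]/(restriction D ht kt (haar2 R I J) - (lam *: capon (haar2 R I J) +
  mu0 *: (haar2 R I J - capon (haar2 R I J)))).
rewrite restriction_haar2 /capon haar_multiplierE.
have -> : (len R I <= len R J) = (level J <= level I)%N.
  by rewrite /len lef_pV2 ?posrE ?exprn_gt0 // ler_eXn2l // ltr1n.
case: ifP => _; rewrite scalerBl ?scale1r ?scale0r ?subrr ?subr0 ?scaler0 ?addr0 //.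
by rewrite add0r.
Qed.

End Restriction.

(** * Faithful Haar systems with constant signs *)

Lemma bits_ext (I J : dyadic) : level I = level J ->
  (forall q, (q < level I)%N -> bits I q = bits J q) -> I = J.
Proof.
move: {2}(level I) (erefl (level I)) => l.
elim: l I J => [|l IH] I J lI eIJ hb.
  apply: dyadic_eq => //; have := ltn_ord (tagged I); have := ltn_ord (tagged J).
  rewrite -/(position I) -/(position J) -/(level I) -/(level J) -eIJ lI expn0.
  by rewrite !ltnS !leqn0 => /eqP -> /eqP ->.
have [I' [v [lI' eI]]] := parent lI.
have [J' [w [lJ' eJ]]] := parent (etrans (esym eIJ) lI).
have eI'J' : I' = J'.
  apply: IH => [||q]; rewrite ?lI' ?lJ' // => ql.
  have := hb q; rewrite eI eJ !bits_child_lt ?lI' ?lJ' //; apply.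
  by rewrite /level /= -/(level I') lI' ltnS ltnW.
have : bits I l = bits J l by apply: hb; rewrite lI.
by rewrite eI eJ -{1}lI' -lJ' !bits_child_level eI'J' => /(can_inj negbK) ->.
Qed.

(** For a point of $[0,1)$ with binary digits [x], this is membership in $\Gamma_I$. It reads [m]
    only below [level I]. *)
Definition agree (m : nat -> nat) (I : dyadic) (x : nat -> bool) : bool :=
  all (fun l => x (m l) == bits I l) (iota 0 (level I)).

Lemma agreeP m I x : reflect (forall l, (l < level I)%N -> x (m l) = bits I l)
  (agree m I x).
Proof.
apply: (iffP allP) => h l.
  by move=> lI; apply/eqP/h; rewrite mem_iota.
by rewrite mem_iota => /andP[_ lI]; apply/eqP/h.
Qed.

Lemma agree_child m I w x :
  agree m (child I w) x = agree m I x && (x (m (level I)) == ~~ w).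
Proof.
apply/agreeP/andP => [h|[/agreeP h /eqP e] l].
  split; last by rewrite h ?bits_child_level.
  by apply/agreeP => l lI; rewrite h ?bits_child_lt // ltnW.
rewrite ltnS leq_eqVlt => /orP[/eqP ->|lI]; last by rewrite bits_child_lt // h.
by rewrite e bits_child_level.
Qed.

Lemma eq_agree m I x y : (forall l, (l < level I)%N -> x (m l) = y (m l)) ->
  agree m I x = agree m I y.
Proof. by move=> h; apply/agreeP/agreeP => H l lI; rewrite -H // h. Qed.

Lemma sum_agree (R : pzSemiRingType) m (i : nat) x :
  \sum_(I : 'I_(2 ^ i)) (agree m (dy I) x)%:R = 1 :> R.
Proof.
elim: i => [|i IH].
  rewrite (eq_bigr (fun=> 1)); last by move=> I _.
  by rewrite sumr_const card_ord expn0.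
rewrite (sum_dyadicS i (fun I => (agree m I x)%:R)) -[RHS]IH.
apply: eq_bigr => I _; rewrite big_bool /= !agree_child.
by case: (agree m (dy I) x); case: (x _); rewrite /= ?addr0 ?add0r.
Qed.

Definition cells (m : nat -> nat) (I : dyadic) : {fset dyadic} :=
  [fset K in [seq dy k | k <- enum 'I_(2 ^ m (level I)) & agree m I (bits (dy k))]]%fset.

Lemma in_cells m I K :
  (K \in cells m I) = (level K == m (level I)) && agree m I (bits K).
Proof.
rewrite in_fset /=; apply/idP/andP => [/mapP[k]|[/eqP]].
  by rewrite mem_filter => /andP[a _] ->.
move=> e a; have hk : (position K < 2 ^ m (level I))%N by rewrite -e; exact: ltn_ord.
have eK : K = dy (Ordinal hk) by apply: dyadic_eq.
by apply/mapP; exists (Ordinal hk); rewrite // mem_filter mem_enum andbT -eK.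
Qed.

Lemma sum_cells (V : pzSemiRingType) m I (F : dyadic -> V) :
  \sum_(K <- cells m I) F K =
  \sum_(k : 'I_(2 ^ m (level I))) (agree m I (bits (dy k)))%:R * F (dy k).
Proof.
rewrite (perm_big [seq dy k | k <- enum 'I_(2 ^ m (level I)) & agree m I (bits (dy k))]).
  rewrite big_map big_filter big_enum_cond /= big_mkcond /=.
  by apply: eq_bigr => k _; case: ifP; rewrite ?mul1r ?mul0r.
apply: uniq_perm; first exact: fset_uniq.
  rewrite map_inj_in_uniq; first by rewrite filter_uniq ?enum_uniq.
  by move=> k l _ _ /(congr1 position) kl; apply: val_inj.
by move=> K; rewrite in_fset.
Qed.

(** By strict monotonicity of [m], the level of [K] determines that of [I]; the digits of [K] at the
    places [m l] then determine [I]. *)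
Lemma cells_disj m I J K : {homo m : i j / (i < j)%N} ->
  K \in cells m I -> K \in cells m J -> I = J.
Proof.
move=> hm; rewrite !in_cells => /andP[/eqP lI /agreeP aI] /andP[/eqP lJ /agreeP aJ].
have e : level I = level J.
  by case: (ltngtP (level I) (level J)) => // /hm; rewrite -lI -lJ ltnn.
by apply: bits_ext => // q qI; rewrite -aI // aJ // -e.
Qed.

Section FaithfulSystem.
Variables (R : realType) (m : nat -> nat).
Hypothesis m_incr : {homo m : i j / (i < j)%N}.

Definition rademacher_system (I : dyadic) : V1 R := \sum_(K <- cells m I) haar R K.

Lemma support_cells I s : support_of R (cells m I) s <->
  (0 <= s < 1) && agree m I (sbit s).
Proof.
have agr K : level K = m (level I) -> dmem K s ->
    agree m I (bits K) = agree m I (sbit s).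
  by move=> lK Ks; apply: eq_agree => l lI; rewrite (dmem_bits Ks) // lK m_incr.
split.
  move=> [K /= + /interval_ofE Ks]; rewrite in_cells => /andP[/eqP lK].
  by rewrite (dmem01 Ks) agr.
move=> /andP[s01 a]; have [K [lK Ks]] := dmem_ex (m (level I)) s01.
by exists K; [rewrite /= in_cells lK eqxx agr|exact/interval_ofE].
Qed.

(** That is, $\tilde h_I=\chi_{\Gamma_I}r_{m_i}$ with $i$ the level of $I$: exactly one interval of
    level $m_i$ contains a given point of $[0,1)$, so at most one summand is nonzero there. *)
Lemma rademacher_systemE I s : val (rademacher_system I) s =
  ((0 <= s < 1) && agree m I (sbit s))%:R * (-1) ^+ sbit s (m (level I)).
Proof.
rewrite /rademacher_system val_haar_sum.
case: (boolP (0 <= s < 1)) => [s01|s01] /=; last first.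
  rewrite mul0r big1 // => K _; rewrite haar_funE.
  by case: (boolP (dmem K s)) s01 => [/dmem01 ->//|]; rewrite mul0r.
have [K0 [lK Ks]] := dmem_ex (m (level I)) s01.
transitivity (\sum_(K <- cells m I) haar_fun R K s * (K0 == K)%:R).
  apply: eq_big_seq => K; rewrite in_cells => /andP[/eqP lK' _].
  case: eqP => [_|ne]; rewrite ?mulr1 // mulr0 haar_funE.
  case: (boolP (dmem K s)) => [Ks'|]; last by rewrite mul0r.
  by case: ne; apply: (dmem_inj _ Ks Ks'); rewrite lK lK'.
rewrite sum_delta ?fset_uniq // haar_funE Ks mul1r lK in_cells lK eqxx /=.
congr ((nat_of_bool _)%:R * _); apply: eq_agree => l lI.
by rewrite (dmem_bits Ks) // lK m_incr.
Qed.

(** The value of $\tilde h_I$ on $\Gamma_I$ is the sign of the digit at place [m (level I)], which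
    by [agree_child] is exactly the digit separating $\Gamma_{I^+}$ from $\Gamma_{I^-}$. *)
Lemma rademacher_faithful : faithful_haar_system_rel rademacher_system m.
Proof.
split=> //; exists (cells m); split; last first.
  by move=> I K; rewrite in_cells => /andP[/eqP].
split.
- move=> I K L; rewrite !in_cells => /andP[/eqP lK _] /andP[/eqP lL _] /eqP KL.
  apply/seteqP; split => // s [/interval_ofE Ks /interval_ofE Ls].
  by case: KL; apply: (dmem_inj _ Ks Ls); rewrite lK lL.
- move=> I; exists (fun=> false); apply: eq_bigr => K _.
  by rewrite expr0 scale1r.
- apply/seteqP; split => s.
    by move=> /support_cells /andP[s01 _]; rewrite /= in_itv.
  by rewrite /= in_itv /= => s01; apply/support_cells; rewrite s01.
- move=> I; apply/seteqP; split => s.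
    move=> /support_cells; rewrite agree_child andbA => /andP[h /eqP e].
    by rewrite /= rademacher_systemE h e mul1r.
  rewrite /= rademacher_systemE => h; apply/support_cells; rewrite agree_child andbA.
  case: (_ && agree m I _) h => /=; case: (sbit s _) => //=.
  + by rewrite mul1r expr1 => /eqP; rewrite eqNr oner_eq0.
  + by rewrite mul0r => /eqP; rewrite eq_sym oner_eq0.
  + by rewrite mul0r => /eqP; rewrite eq_sym oner_eq0.
- move=> I; apply/seteqP; split => s.
    move=> /support_cells; rewrite agree_child andbA => /andP[h /eqP e].
    by rewrite /= rademacher_systemE h e mul1r.
  rewrite /= rademacher_systemE => h; apply/support_cells; rewrite agree_child andbA.
  case: (_ && agree m I _) h => /=; case: (sbit s _) => //=.
  + by rewrite mul1r expr0 => /eqP; rewrite eq_sym eqNr oner_eq0.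
  + by rewrite mul0r => /eqP; rewrite eq_sym oppr_eq0 oner_eq0.
  + by rewrite mul0r => /eqP; rewrite eq_sym oppr_eq0 oner_eq0.
Qed.

End FaithfulSystem.

(** * Entries and block means of the restricted multiplier as weighted means *)

(** The weight [g] depends on digit sequences rather than intervals, so that one and the same [g]
    makes sense at all levels [i], [j] while these tend to infinity. *)
Definition weighted_mean (R : realType) (e : dyadic -> dyadic -> R) (i j : nat)
    (g : (nat -> bool) -> (nat -> bool) -> R) : R :=
  \sum_(I : 'I_(2 ^ i)) \sum_(J : 'I_(2 ^ j))
    len R (dy I) * len R (dy J) * e (dy I) (dy J) * g (bits (dy I)) (bits (dy J)).

(** For increasing [m] one has $|\Gamma_I|=|I|$, so this is the density of the uniform probability
    on $\Gamma_I$, that is, the product of the factors $1\pm r_{m_l}$ over [l < level I]. *)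
Definition cyl (R : realType) (m : nat -> nat) (I : dyadic) (x : nat -> bool) : R :=
  (agree m I x)%:R / len R I.

Section RestrictionEntries.
Variables (R : realType) (D : {linear V2 R -> V2 R}) (hD : is_haar_multiplier D).
Variables (m n : nat -> nat).
Hypotheses (m_incr : {homo m : i j / (i < j)%N}) (n_incr : {homo n : i j / (i < j)%N}).

Let DR := restriction D (rademacher_system R m) (rademacher_system R n).

Lemma entry_rademacher I J : entry DR I J =
  weighted_mean (entry D) (m (level I)) (n (level J))
    (fun x y => cyl R m I x * cyl R n J y).
Proof.
rewrite /DR (entry_restriction hD) //; last first.
- by move=> ? ? ?; exact: cells_disj.
- by move=> ? ? ?; exact: cells_disj.
rewrite sum_cells /weighted_mean mulr_suml; apply: eq_bigr => k _.
rewrite sum_cells mulr_sumr mulr_suml; apply: eq_bigr => l _.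
by rewrite /cyl invfM; ring.
Qed.

(** Multiplying by $|I||J|$ cancels the normalisation of the densities, and what remains sums to 1
    because each digit sequence agrees with exactly one interval per level ([sum_agree]). *)
Lemma block_mean_rademacher i j :
  block_mean DR i j = weighted_mean (entry D) (m i) (n j) (fun _ _ => 1).
Proof.
rewrite /block_mean /weighted_mean.
transitivity (\sum_(I : 'I_(2 ^ i)) \sum_(J : 'I_(2 ^ j))
    \sum_(k : 'I_(2 ^ m i)) \sum_(l : 'I_(2 ^ n j))
    ((agree m (dy I) (bits (dy k)))%:R * ((agree n (dy J) (bits (dy l)))%:R *
     (len R (dy k) * len R (dy l) * entry D (dy k) (dy l))))).
  apply: eq_bigr => I _; apply: eq_bigr => J _.
  rewrite entry_rademacher /weighted_mean !level_dy mulr_sumr.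
  apply: eq_bigr => k _; rewrite mulr_sumr; apply: eq_bigr => l _.
  rewrite /cyl; have := len_neq0 R (dy I); have := len_neq0 R (dy J).
  by move=> lI lJ; field; rewrite lI lJ.
under eq_bigr do rewrite exchange_big /=.
rewrite exchange_big /=; apply: eq_bigr => k _.
under eq_bigr do rewrite exchange_big /=.
rewrite exchange_big /=; apply: eq_bigr => l _.
under eq_bigr do rewrite -mulr_sumr -mulr_suml sum_agree mul1r.
by rewrite -mulr_suml sum_agree mul1r mulr1.
Qed.

End RestrictionEntries.

(** * Bessel's inequality for weighted means *)

Section Bessel.
Variable R : realType.

(** Expand the weighted mean of $(f-S)^2\ge0$, where [S] is the orthogonal projection of [f] on the
    span of the [r q]. *)
Lemma bessel (T : finType) (N : nat) (w f : T -> R) (r : 'I_N -> T -> R) (C : R) :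
  (forall t, 0 <= w t) -> \sum_t w t = 1 -> (forall t, `|f t| <= C) ->
  (forall p q, \sum_t w t * (r p t * r q t) = (p == q)%:R) ->
  \sum_q (\sum_t w t * (f t * r q t)) ^+ 2 <= C ^+ 2.
Proof.
move=> w0 w1 fC ortho; pose u q := \sum_t w t * (f t * r q t).
pose S t := \sum_q u q * r q t.
have h1 : \sum_t w t * (f t * S t) = \sum_q u q ^+ 2.
  under eq_bigr do rewrite /S !mulr_sumr.
  rewrite exchange_big /=; apply: eq_bigr => q _.
  rewrite expr2 [X in _ = _ * X]/u mulr_sumr; apply: eq_bigr => t _; ring.
have h2 : \sum_t w t * (S t * S t) = \sum_q u q ^+ 2.
  transitivity (\sum_p \sum_q u p * u q * \sum_t w t * (r p t * r q t)).
    under [RHS]eq_bigr do under eq_bigr do rewrite mulr_sumr.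
    under [RHS]eq_bigr do rewrite exchange_big.
    rewrite [RHS]exchange_big; apply: eq_bigr => t _.
    rewrite /S big_distrlr /= mulr_sumr; apply: eq_bigr => p _.
    by rewrite mulr_sumr; apply: eq_bigr => q _; ring.
  apply: eq_bigr => p _; rewrite (bigD1 p) //= [X in _ + X]big1 ?addr0.
    by rewrite ortho eqxx mulr1.
  by move=> q qp; rewrite ortho eq_sym (negbTE qp) mulr0.
have h3 : \sum_t w t * f t ^+ 2 <= C ^+ 2.
  rewrite -[leRHS]mul1r -w1 mulr_suml; apply: ler_sum => t _.
  apply: ler_wpM2l => //; rewrite -real_normK ?num_real //.
  by rewrite lerXn2r ?nnegrE // (le_trans _ (fC t)).
have h4 : 0 <= \sum_t w t * (f t - S t) ^+ 2.
  by apply: sumr_ge0 => t _; rewrite mulr_ge0 // sqr_ge0.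
have h5 : \sum_t w t * (f t - S t) ^+ 2 = \sum_t w t * f t ^+ 2 -
    (\sum_t w t * (f t * S t)) *+ 2 + \sum_t w t * (S t * S t).
  rewrite -sumrMnl -sumrB -big_split /=; apply: eq_bigr => t _.
  by rewrite mulr2n; ring.
move: h4; rewrite h5 h1 h2 mulr2n opprD addrA subrK subr_ge0 => h.
exact: le_trans h h3.
Qed.

Lemma sum_len i : \sum_(I : 'I_(2 ^ i)) len R (dy I) = 1.
Proof.
rewrite (eq_bigr (fun=> 2 ^- i)) // sumr_const card_ord -[LHS]mulr_natr natrX.
by rewrite mulVf // expf_neq0.
Qed.

Lemma len_ge0 I : 0 <= len R I. Proof. by rewrite /len invr_ge0 exprn_ge0. Qed.

(** At level [q.+1] the two children of each interval contribute opposite signs; each further level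
    merely doubles the sum. *)
Lemma rademacher_lt i p q : (p < q)%N -> (q < i)%N ->
  \sum_(I : 'I_(2 ^ i)) (-1) ^+ bits (dy I) p * (-1) ^+ bits (dy I) q = 0 :> R.
Proof.
move=> pq; elim: i => // i IH; rewrite ltnS leq_eqVlt => /orP[/eqP <-|qi].
  rewrite (sum_dyadicS q (fun I => (-1) ^+ bits I p * (-1) ^+ bits I q)).
  rewrite big1 // => I _; rewrite big_bool /= !(@bits_child_lt (dy I) _ p pq).
  have E w : bits (child (dy I) w) q = ~~ w := bits_child_level (dy I) w.
  by rewrite !E /= expr0 expr1 mulrN1 mulr1 subrr.
rewrite (sum_dyadicS i (fun I => (-1) ^+ bits I p * (-1) ^+ bits I q)).
transitivity (\sum_(I : 'I_(2 ^ i))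
    (((-1) ^+ bits (dy I) p * (-1) ^+ bits (dy I) q) *+ 2) : R).
  have pi := ltn_trans pq qi.
  by apply: eq_bigr => I _; rewrite big_bool /= !(bits_child_lt (I := dy I)).
by under eq_bigr do rewrite mulr2n; rewrite big_split /= IH // addr0.
Qed.

Lemma rademacher_ortho i N (p q : 'I_N) : (N <= i)%N ->
  \sum_(I : 'I_(2 ^ i)) len R (dy I) *
    ((-1) ^+ bits (dy I) p * (-1) ^+ bits (dy I) q) = (p == q)%:R.
Proof.
move=> Ni; have iN (k : 'I_N) : (k < i)%N := leq_trans (ltn_ord k) Ni.
have [->|pq] := eqVneq p q.
  rewrite -[RHS](sum_len i); apply: eq_bigr => I _.
  by rewrite -expr2 sqrr_sign mulr1.
transitivity (2 ^- i * \sum_(I : 'I_(2 ^ i))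
    (-1) ^+ bits (dy I) p * (-1) ^+ bits (dy I) q : R); first by rewrite mulr_sumr.
have [h|h|h] := ltngtP (p : nat) q; first by rewrite rademacher_lt // mulr0.
  under eq_bigr do rewrite mulrC.
  by rewrite rademacher_lt // mulr0.
by move: pq; rewrite -val_eqE /= h eqxx.
Qed.

Variables (e : dyadic -> dyadic -> R) (M : R).
Hypothesis e_bound : forall I J, `|e I J| <= M.

Lemma weighted_meanE i j g : weighted_mean e i j g =
  \sum_(t : 'I_(2 ^ i) * 'I_(2 ^ j)) len R (dy t.1) * len R (dy t.2) *
    (e (dy t.1) (dy t.2) * g (bits (dy t.1)) (bits (dy t.2))).
Proof.
rewrite /weighted_mean pair_bigA /=.
by apply: eq_bigr => t _; rewrite mulrA.
Qed.

Lemma sum_len2 i j :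
  \sum_(t : 'I_(2 ^ i) * 'I_(2 ^ j)) len R (dy t.1) * len R (dy t.2) = 1.
Proof.
rewrite -(pair_bigA _ (fun I J => len R (dy I) * len R (dy J))) /=.
by under eq_bigr do rewrite -mulr_sumr sum_len mulr1; rewrite sum_len.
Qed.

Lemma mul_bound (C x y : R) : `|x| <= M -> `|y| <= C -> `|x * y| <= M * C.
Proof. by move=> hx hy; rewrite normrM ler_pM. Qed.

Lemma weighted_mean_bound i j g C : (forall x y, `|g x y| <= C) ->
  `|weighted_mean e i j g| <= M * C.
Proof.
move=> gC; rewrite weighted_meanE -[leRHS]mul1r -(sum_len2 i j) mulr_suml.
apply: le_trans (ler_norm_sum _ _ _) _; apply: ler_sum => t _.
have l0 : 0 <= len R (dy t.1) * len R (dy t.2) by rewrite mulr_ge0 // len_ge0.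
by rewrite normrM (ger0_norm l0) ler_wpM2l // mul_bound.
Qed.

Definition xrad (g : (nat -> bool) -> (nat -> bool) -> R) (q : nat) :=
  fun x y : nat -> bool => g x y * (-1) ^+ x q.
Definition yrad (g : (nat -> bool) -> (nat -> bool) -> R) (q : nat) :=
  fun x y : nat -> bool => g x y * (-1) ^+ y q.

(** The condition [N <= i] ensures that all digits in question exist: beyond the level, [bits] only
    repeats the last digit and orthogonality fails. *)
Lemma bessel_x N i j g C : (forall x y, `|g x y| <= C) -> (N <= i)%N ->
  \sum_(q < N) weighted_mean e i j (xrad g q) ^+ 2 <= (M * C) ^+ 2.
Proof.
move=> gC Ni.
pose w (t : 'I_(2 ^ i) * 'I_(2 ^ j)) := len R (dy t.1) * len R (dy t.2).
pose f (t : 'I_(2 ^ i) * 'I_(2 ^ j)) :=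
  e (dy t.1) (dy t.2) * g (bits (dy t.1)) (bits (dy t.2)).
rewrite (eq_bigr (fun q : 'I_N => (\sum_t w t * (f t * (-1) ^+ bits (dy t.1) q)) ^+ 2)).
  apply: (@bessel _ _ w f (fun q t => (-1) ^+ bits (dy t.1) q)).
  - by move=> t; rewrite mulr_ge0 // len_ge0.
  - exact: sum_len2.
  - by move=> t; exact: mul_bound.
  - move=> p q; rewrite -(@rademacher_ortho i N) //.
    rewrite -(pair_bigA _ (fun I J => len R (dy I) * len R (dy J) *
      ((-1) ^+ bits (dy I) p * (-1) ^+ bits (dy I) q))) /=.
    apply: eq_bigr => I _; rewrite -mulr_suml -mulr_sumr sum_len mulr1 //.
move=> q _; congr (_ ^+ 2); rewrite weighted_meanE; apply: eq_bigr => t _.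
by rewrite /w /f /xrad !mulrA.
Qed.

End Bessel.

Lemma weighted_mean_swap (R : realType) (e : dyadic -> dyadic -> R) i j g :
  weighted_mean e i j g = weighted_mean (fun I J => e J I) j i (fun x y => g y x).
Proof.
rewrite /weighted_mean exchange_big; apply: eq_bigr => J _; apply: eq_bigr => I _.
by rewrite (mulrC (len R (dy I))).
Qed.

Lemma bessel_y (R : realType) (e : dyadic -> dyadic -> R) (M : R) N i j g C :
  (forall I J, `|e I J| <= M) -> (forall x y, `|g x y| <= C) -> (N <= j)%N ->
  \sum_(q < N) weighted_mean e i j (yrad g q) ^+ 2 <= (M * C) ^+ 2.
Proof.
move=> eM gC Nj; under eq_bigr do rewrite weighted_mean_swap.
by apply: (@bessel_x _ (fun I J => e J I) M _ N j i (fun x y => g y x) C).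
Qed.

Lemma weighted_mean_lin (R : realType) (e : dyadic -> dyadic -> R) i j g h (s : R) :
  weighted_mean e i j (fun x y => g x y + s * h x y) =
  weighted_mean e i j g + s * weighted_mean e i j h.
Proof.
rewrite !weighted_meanE mulr_sumr -big_split /=; apply: eq_bigr => t _; ring.
Qed.

(** * Iterated limits along the ultrafilter *)

Section UltraLimits.
Variables (R : realType) (U : set_system nat).
Hypotheses (ultraU : UltraFilter U) (freeU : forall n : nat, ~ U [set n]).
Implicit Types (u v : nat -> R) (C eps : R).

Definition ulim u : R := lim (u j @[j --> U]).

(** By compactness the image of [U] has a cluster point [p]. If the preimage of a neighbourhood of
    [p] were not in [U], its complement would be, contradicting clustering. *)
Lemma ultra_cvg u C : (forall j, `|u j| <= C) -> u j @[j --> U] --> ulim u.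
Proof.
move=> uC; have : compact `[- C, C]%classic by exact: segment_compact.
move=> /(_ (u j @[j --> U]) _) [|p [_ clp]].
  have : U (u @^-1` `[- C, C]%classic).
    by apply: filterE => j; rewrite /= in_itv /= -ler_norml.
  by [].
suff h : u j @[j --> U] --> p by apply/cvg_ex; exists p.
move=> B pB; have [//|UB] := in_ultra_setVsetC (u @^-1` B) ultraU.
by have [y [yB yp]] := clp (~` B) B UB pB.
Qed.

Lemma ulim_near u C eps : (forall j, `|u j| <= C) -> 0 < eps ->
  \forall j \near U, `|u j - ulim u| < eps.
Proof.
move=> /ultra_cvg /cvgrPdist_lt/[apply]; apply: filterS => j.
by rewrite distrC.
Qed.

Lemma ulim_eq u l : (forall eps, 0 < eps -> \forall j \near U, `|u j - l| < eps) ->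
  ulim u = l.
Proof.
move=> h; apply: cvg_lim => //; apply/cvgrPdist_lt => eps /h.
by apply: filterS => j; rewrite distrC.
Qed.

Lemma ulim_bound u C : (forall j, `|u j| <= C) -> `|ulim u| <= C.
Proof.
move=> uC; have uU := ultra_cvg uC; rewrite ler_norml; apply/andP; split.
  apply: limr_ge; first by apply/cvg_ex; exists (ulim u).
  by apply: filterE => j; have := uC j; rewrite ler_norml => /andP[].
apply: limr_le; first by apply/cvg_ex; exists (ulim u).
by apply: filterE => j; have := uC j; rewrite ler_norml => /andP[].
Qed.

Lemma ulim_lin u v C C' s : (forall j, `|u j| <= C) -> (forall j, `|v j| <= C') ->
  ulim (fun j => u j + s * v j) = ulim u + s * ulim v.
Proof.
move=> /ultra_cvg hu /ultra_cvg hv; apply: cvg_lim => //.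
by apply: cvgD => //; apply: cvgMr.
Qed.

Lemma ulim_sum_sqr N (u : nat -> nat -> R) C B :
  (forall q j, `|u q j| <= C) ->
  (\forall j \near U, \sum_(q < N) u q j ^+ 2 <= B) ->
  \sum_(q < N) ulim (u q) ^+ 2 <= B.
Proof.
move=> uC h.
have cv n : \sum_(q < n) u q j ^+ 2 @[j --> U] --> \sum_(q < n) ulim (u q) ^+ 2.
  elim: n => [|n IH].
    by rewrite big_ord0; under eq_fun do rewrite big_ord0; exact: cvg_cst.
  rewrite big_ord_recr; under eq_fun do rewrite big_ord_recr /=.
  apply: cvgD => //; under eq_fun do rewrite expr2; rewrite expr2.
  by apply: cvgM; exact: (ultra_cvg (uC n)).
rewrite -(cvg_lim _ (cv N)) //; apply: limr_le => //.
by apply/cvg_ex; eexists; exact: cv.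
Qed.

(** A non-principal ultrafilter contains the complement of every singleton, hence all tails. *)
Lemma near_ultra_ge N : \forall j \near U, (N <= j)%N.
Proof.
elim: N => [|N IH]; first exact: filterE.
have [/freeU//|h] := in_ultra_setVsetC [set N] ultraU.
apply: filterS2 IH h => j Nj /= jN; rewrite ltn_neqAle Nj andbT.
by apply/eqP => e; exact: jN (esym e).
Qed.

(** Bounded partial sums of squares converge, so the terms tend to 0 in the usual sense and a
    fortiori along [U]. *)
Lemma square_summable_small (c : nat -> R) B eps :
  (forall N, \sum_(q < N) c q ^+ 2 <= B) -> 0 < eps ->
  \forall q \near U, `|c q| < eps.
Proof.
move=> hB eps0.
have cs : cvgn (series (fun q => c q ^+ 2)).
  apply: nondecreasing_is_cvgn.
    apply/nondecreasing_seqP => n; rewrite /series /= big_nat_recr //= lerDl.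
    exact: sqr_ge0.
  by exists B => _ [n _ <-]; rewrite /series /= big_mkord.
have /cvgrPdist_lt/(_ (eps ^+ 2)) := cvg_series_cvg_0 cs.
move=> /(_ (exprn_gt0 _ eps0)) [N _ hN].
apply: filterS (near_ultra_ge N) => q /hN /=.
rewrite sub0r normrN ger0_norm ?sqr_ge0 // -real_normK ?num_real //.
by rewrite ltr_pXn2r // nnegrE ltW.
Qed.

End UltraLimits.

Section IteratedLimits.
Variables (R : realType) (U : set_system nat).
Hypotheses (ultraU : UltraFilter U) (freeU : forall n : nat, ~ U [set n]).
Local Notation pairfun := ((nat -> bool) -> (nat -> bool) -> R).
Implicit Types (e : dyadic -> dyadic -> R) (g h : pairfun).

(** The order of limits is that of [lambda]: first the level of [I] with that of [J] fixed, then the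
    level of [J]. *)
Definition col_lim e (j : nat) g : R := ulim U (fun i => weighted_mean e i j g).
Definition iter_lim e g : R := ulim U (fun j => col_lim e j g).

Definition bounded2 g := exists C : R, forall x y, `|g x y| <= C.

Lemma bounded2_xrad g q : bounded2 g -> bounded2 (xrad g q).
Proof.
by move=> [C hC]; exists C => x y; rewrite /xrad normrM normrX normrN1 expr1n mulr1.
Qed.

Lemma bounded2_yrad g q : bounded2 g -> bounded2 (yrad g q).
Proof.
by move=> [C hC]; exists C => x y; rewrite /yrad normrM normrX normrN1 expr1n mulr1.
Qed.

Variables (e : dyadic -> dyadic -> R) (M : R).
Hypothesis e_bound : forall I J, `|e I J| <= M.

Lemma col_lim_bound j g C : (forall x y, `|g x y| <= C) -> `|col_lim e j g| <= M * C.
Proof. by move=> gC; apply: ulim_bound => // i; exact: weighted_mean_bound. Qed.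

Lemma near_col_lim j g eps : bounded2 g -> 0 < eps ->
  \forall i \near U, `|weighted_mean e i j g - col_lim e j g| < eps.
Proof.
by move=> [C gC]; apply: (@ulim_near _ _ _ _ (M * C)) => // i; exact: weighted_mean_bound.
Qed.

Lemma near_iter_lim g eps : bounded2 g -> 0 < eps ->
  \forall j \near U, `|col_lim e j g - iter_lim e g| < eps.
Proof.
by move=> [C gC]; apply: (@ulim_near _ _ _ _ (M * C)) => // j; exact: col_lim_bound.
Qed.

Lemma col_lim_lin j g h s : bounded2 g -> bounded2 h ->
  col_lim e j (fun x y => g x y + s * h x y) = col_lim e j g + s * col_lim e j h.
Proof.
move=> [C gC] [C' hC]; rewrite /col_lim.
under [X in ulim U X]eq_fun do rewrite weighted_mean_lin.
by apply: (@ulim_lin _ _ _ _ _ (M * C) (M * C')) => // i; exact: weighted_mean_bound.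
Qed.

Lemma iter_lim_lin g h s : bounded2 g -> bounded2 h ->
  iter_lim e (fun x y => g x y + s * h x y) = iter_lim e g + s * iter_lim e h.
Proof.
move=> bg bh; have [C gC] := bg; have [C' hC] := bh; rewrite /iter_lim.
under [X in ulim U X]eq_fun do rewrite col_lim_lin //.
by apply: (@ulim_lin _ _ _ _ _ (M * C) (M * C')) => // i; exact: col_lim_bound.
Qed.

(** Here [i] runs along [U], so eventually [N <= i] and the bound holds for every [j] and all [N].
    For [yrad], with [j] fixed, [N <= j] must be assumed, and it is met only after the outer
    limit. *)
Lemma col_lim_bessel_x N j g C : (forall x y, `|g x y| <= C) ->
  \sum_(q < N) col_lim e j (xrad g q) ^+ 2 <= (M * C) ^+ 2.
Proof.
move=> gC.
apply: (@ulim_sum_sqr _ _ _ N (fun q i => weighted_mean e i j (xrad g q)) (M * C)) => //.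
  move=> q i; apply: weighted_mean_bound => // x y.
  by rewrite /xrad normrM normrX normrN1 expr1n mulr1.
by apply: filterS (near_ultra_ge ultraU freeU N) => i; exact: bessel_x.
Qed.

Lemma col_lim_bessel_y N j g C : (forall x y, `|g x y| <= C) -> (N <= j)%N ->
  \sum_(q < N) col_lim e j (yrad g q) ^+ 2 <= (M * C) ^+ 2.
Proof.
move=> gC Nj.
apply: (@ulim_sum_sqr _ _ _ N (fun q i => weighted_mean e i j (yrad g q)) (M * C)) => //.
  move=> q i; apply: weighted_mean_bound => // x y.
  by rewrite /yrad normrM normrX normrN1 expr1n mulr1.
by apply: filterE => i; exact: bessel_y.
Qed.

Lemma col_lim_xrad_small j g eps : bounded2 g -> 0 < eps ->
  \forall q \near U, `|col_lim e j (xrad g q)| < eps.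
Proof.
move=> [C gC]; apply: (@square_summable_small _ _ _ _ _ ((M * C) ^+ 2)) => // N.
exact: col_lim_bessel_x.
Qed.

Lemma iter_lim_xrad_small g eps : bounded2 g -> 0 < eps ->
  \forall q \near U, `|iter_lim e (xrad g q)| < eps.
Proof.
move=> [C gC]; apply: (@square_summable_small _ _ _ _ _ ((M * C) ^+ 2)) => // N.
apply: (@ulim_sum_sqr _ _ _ N (fun q j => col_lim e j (xrad g q)) (M * C)) => //.
  move=> q j; apply: col_lim_bound => x y.
  by rewrite /xrad normrM normrX normrN1 expr1n mulr1.
by apply: filterE => j; exact: col_lim_bessel_x.
Qed.

Lemma iter_lim_yrad_small g eps : bounded2 g -> 0 < eps ->
  \forall q \near U, `|iter_lim e (yrad g q)| < eps.
Proof.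
move=> [C gC]; apply: (@square_summable_small _ _ _ _ _ ((M * C) ^+ 2)) => // N.
apply: (@ulim_sum_sqr _ _ _ N (fun q j => col_lim e j (yrad g q)) (M * C)) => //.
  move=> q j; apply: col_lim_bound => x y.
  by rewrite /yrad normrM normrX normrN1 expr1n mulr1.
by apply: filterS (near_ultra_ge ultraU freeU N) => j; exact: col_lim_bessel_y.
Qed.

End IteratedLimits.

(** * Choice of the frequencies *)

(** Recursive choice with memory, for conditions that see only the values of [f] chosen earlier. *)
Lemma prefix_choice (T : Type) (x0 : T) (P : nat -> (nat -> T) -> T -> Prop) :
  (forall k f f' x, (forall l, (l < k)%N -> f l = f' l) -> P k f x -> P k f' x) ->
  (forall k f, exists x, P k f x) -> exists f, forall k, P k f (f k).
Proof.
move=> Pext Pex.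
have [c hc] := choice (fun kf : nat * (nat -> T) => Pex kf.1 kf.2).
(* [F k] holds the first [k] choices and the filler [x0] beyond; [Fstab] says that a value never
   changes once chosen, so the diagonal [F k.+1 k] is the required sequence. *)
pose F := fix F k := if k is k'.+1 then
  fun l => if l == k' then c (k', F k') else F k' l else fun=> x0.
have Fstab l d : F (l.+1 + d)%N l = F l.+1 l.
  elim: d => [|d IH]; first by rewrite addn0.
  rewrite addnS -IH /=; case: eqP => // e; exfalso; lia.
exists (fun k => F k.+1 k) => k /=; rewrite eqxx.
apply: Pext (hc (k, F k)) => l lk.
by have := Fstab l (k - l.+1)%N; rewrite subnKC.
Qed.

Section Frequencies.
Variables (R : realType) (U : set_system nat).
Hypotheses (ultraU : UltraFilter U) (freeU : forall n : nat, ~ U [set n]).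
Variables (e : dyadic -> dyadic -> R) (M : R).
Hypothesis e_bound : forall I J, `|e I J| <= M.
Local Notation pairfun := ((nat -> bool) -> (nat -> bool) -> R).
Implicit Types (g : pairfun) (I J : dyadic) (m n : nat -> nat).

Definition cyl2 m n I J : pairfun := fun x y => cyl R m I x * cyl R n J y.

(* Transposing [e] turns [col_lim] into the limit over the second index, and
   [iter_lim] into the iterated limit in the opposite order. *)
Definition row_lim (i : nat) g : R := col_lim U (fun I J => e J I) i (fun x y => g y x).
Definition iter_lim' g : R := iter_lim U (fun I J => e J I) (fun x y => g y x).

Let eT_bound I J : `|(fun I J => e J I) I J| <= M. Proof. exact: e_bound. Qed.

Lemma bounded2_swap g : bounded2 g -> bounded2 (fun x y => g y x).
Proof. by move=> [C hC]; exists C. Qed.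

Lemma cyl_bound m I x : `|cyl R m I x| <= (len R I)^-1.
Proof.
have l0 : 0 <= (len R I)^-1 by rewrite invr_ge0 len_ge0.
by rewrite /cyl; case: agree; rewrite ?mul1r ?mul0r ?normr0 // ger0_norm.
Qed.

Lemma bounded2_cyl2 m n I J : bounded2 (cyl2 m n I J).
Proof.
exists ((len R I)^-1 * (len R J)^-1) => x y.
by rewrite normrM ler_pM ?cyl_bound.
Qed.

Lemma cyl_child m I w x :
  cyl R m (child I w) x = cyl R m I x * (1 + (-1) ^+ (~~ w) * (-1) ^+ x (m (level I))).
Proof.
rewrite /cyl agree_child len_child invf_div mulrA.
case: (agree m I x) => /=; last by rewrite !mul0r.
have := len_neq0 R I.
by case: (x _); case: w => /= h; rewrite ?expr0 ?expr1; field.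
Qed.

Lemma cyl2_childl m n I J w : cyl2 m n (child I w) J =
  fun x y => cyl2 m n I J x y + (-1) ^+ (~~ w) * xrad (cyl2 m n I J) (m (level I)) x y.
Proof.
by apply/funext => x; apply/funext => y; rewrite /cyl2 /xrad cyl_child; ring.
Qed.

Lemma cyl2_childr m n I J w : cyl2 m n I (child J w) =
  fun x y => cyl2 m n I J x y + (-1) ^+ (~~ w) * yrad (cyl2 m n I J) (n (level J)) x y.
Proof.
by apply/funext => x; apply/funext => y; rewrite /cyl2 /yrad cyl_child; ring.
Qed.

Lemma eq_cyl2 m m' n n' I J : (forall l, (l < level I)%N -> m l = m' l) ->
  (forall l, (l < level J)%N -> n l = n' l) -> cyl2 m n I J = cyl2 m' n' I J.
Proof.
move=> hm hn; apply/funext => x; apply/funext => y; rewrite /cyl2 /cyl.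
have -> : agree m I x = agree m' I x.
  by apply/agreeP/agreeP => h l lI; rewrite -h // hm.
have -> // : agree n J y = agree n' J y.
by apply/agreeP/agreeP => h l lI; rewrite -h // hn.
Qed.

(** The demands on the candidate [x] for [n k], when [n l] and [m l] are fixed for [l < k]: limits
    over the second index are nearly attained at [x], and the Rademacher perturbation of the weight
    by digit [x] of the second variable is negligible in all limits under consideration. *)
Definition col_step (k : nat) m n (eps : R) I J (x : nat) : Prop :=
  let g := cyl2 m n I J in
  [/\ `|col_lim U e x g - iter_lim U e g| < eps,
      forall l, (l < k)%N -> `|weighted_mean e (m l) x g - row_lim (m l) g| < eps,
      `|iter_lim U e (yrad g x)| < eps,
      `|iter_lim' (yrad g x)| < eps &
      forall l, (l < k)%N -> `|row_lim (m l) (yrad g x)| < eps].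

(** The same for [m k] and the first variable. The bound is [l <= k] here because [n k] is chosen
    before [m k]. *)
Definition row_step (k : nat) m n (eps : R) I J (x : nat) : Prop :=
  let g := cyl2 m n I J in
  [/\ `|row_lim x g - iter_lim' g| < eps,
      forall l, (l <= k)%N -> `|weighted_mean e x (n l) g - col_lim U e (n l) g| < eps,
      `|iter_lim U e (xrad g x)| < eps,
      `|iter_lim' (xrad g x)| < eps &
      forall l, (l <= k)%N -> `|col_lim U e (n l) (xrad g x)| < eps].

Lemma near_ltn (k : nat) (Phi : nat -> nat -> Prop) :
  (forall l, \forall x \near U, Phi l x) ->
  \forall x \near U, forall l, (l < k)%N -> Phi l x.
Proof.
move=> h; have : \forall x \near U, forall l : 'I_k, Phi l x.
  by apply: filter_forall => l; exact: h.
by apply: filterS => x hx l lk; exact: (hx (Ordinal lk)).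
Qed.

Lemma near_level (a : nat) (Phi : dyadic -> nat -> Prop) :
  (forall I, \forall x \near U, Phi I x) ->
  \forall x \near U, forall I, (level I <= a)%N -> Phi I x.
Proof.
move=> h; have : \forall x \near U, forall l, (l < a.+1)%N ->
    forall k : 'I_(2 ^ l), Phi (dy k) x.
  by apply: near_ltn => l; apply: filter_forall => k; exact: h.
by apply: filterS => x hx I Ia; rewrite (dyE I); exact: hx.
Qed.

Lemma near_row_lim i g eps : bounded2 g -> 0 < eps ->
  \forall j \near U, `|weighted_mean e i j g - row_lim i g| < eps.
Proof.
move=> bg e0; have := near_col_lim ultraU eT_bound i (bounded2_swap bg) e0.
by apply: filterS => j; rewrite -weighted_mean_swap.
Qed.

Lemma near_col_step k m n eps I J : 0 < eps ->
  \forall x \near U, col_step k m n eps I J x.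
Proof.
move=> e0; have bg := bounded2_cyl2 m n I J.
have h1 := near_iter_lim ultraU e_bound bg e0.
have h2 : \forall x \near U, forall l, (l < k)%N ->
    `|weighted_mean e (m l) x (cyl2 m n I J) - row_lim (m l) (cyl2 m n I J)| < eps.
  by apply: near_ltn => l; exact: near_row_lim.
have h3 := iter_lim_yrad_small ultraU freeU e_bound bg e0.
(* Transposition turns [yrad] into [xrad] and the opposite iterated limit into [iter_lim]. *)
have h4 := iter_lim_xrad_small ultraU freeU eT_bound (bounded2_swap bg) e0.
have h5 : \forall x \near U, forall l, (l < k)%N ->
    `|row_lim (m l) (yrad (cyl2 m n I J) x)| < eps.
  apply: near_ltn => l.
  exact: (col_lim_xrad_small ultraU freeU eT_bound _ (bounded2_swap bg) e0).
by near=> x; split; near: x.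
Unshelve. all: by end_near.
Qed.

Lemma near_row_step k m n eps I J : 0 < eps ->
  \forall x \near U, row_step k m n eps I J x.
Proof.
move=> e0; have bg := bounded2_cyl2 m n I J.
have h1 := near_iter_lim ultraU eT_bound (bounded2_swap bg) e0.
have h2 : \forall x \near U, forall l, (l < k.+1)%N ->
    `|weighted_mean e x (n l) (cyl2 m n I J) - col_lim U e (n l) (cyl2 m n I J)| < eps.
  by apply: near_ltn => l; exact: (near_col_lim ultraU e_bound).
have h3 := iter_lim_xrad_small ultraU freeU e_bound bg e0.
have h4 := iter_lim_yrad_small ultraU freeU eT_bound (bounded2_swap bg) e0.
have h5 : \forall x \near U, forall l, (l < k.+1)%N ->
    `|col_lim U e (n l) (xrad (cyl2 m n I J) x)| < eps.
  by apply: near_ltn => l; exact: (col_lim_xrad_small ultraU freeU e_bound).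
by near=> x; split; near: x.
Unshelve. all: by end_near.
Qed.

(** Each stage imposes finitely many conditions, each valid for [U]-almost all candidates. Levels of
    [J] up to [k.+1] are admissible for [m k] since the weight of such a [J] involves only [n 0],
    ..., [n k], which are already known. *)
Lemma frequencies (eps : nat -> R) : (forall k, 0 < eps k) ->
  exists m n, [/\ {homo m : i j / (i < j)%N}, {homo n : i j / (i < j)%N},
    forall k I J, (level I <= k)%N -> (level J <= k)%N ->
      col_step k m n (eps k) I J (n k) &
    forall k I J, (level I <= k)%N -> (level J <= k.+1)%N ->
      row_step k m n (eps k) I J (m k)].
Proof.
move=> eps0.
pose Pn k m n x := (forall l, (l < k)%N -> (n l < x)%N) /\
  forall I, (level I <= k)%N -> forall J, (level J <= k)%N ->
    col_step k m n (eps k) I J x.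
pose Pm k m n x := (forall l, (l < k)%N -> (m l < x)%N) /\
  forall I, (level I <= k)%N -> forall J, (level J <= k.+1)%N ->
    row_step k m n (eps k) I J x.
(* [n 0, m 0, n 1, m 1, ...] are the successive terms of one sequence. *)
pose mm (f : nat -> nat) l := f l.*2.+1; pose nn (f : nat -> nat) l := f l.*2.
pose P k f x := if odd k then Pm k./2 (mm f) (nn f) x else Pn k./2 (mm f) (nn f) x.
have [|k f|f hf] := @prefix_choice nat 0%N P.
(* Within the prescribed bounds on the levels, the weights and limits read only frequencies chosen
   earlier, so changing later values of [f] has no effect. *)
- move=> k f f' x ff'; rewrite /P; case: ifP => ok.
    have hm l : (l < k./2)%N -> mm f l = mm f' l by move=> lk; apply: ff'; lia.
    have hn l : (l <= k./2)%N -> nn f l = nn f' l by move=> lk; apply: ff'; lia.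
    move=> [h1 h2]; split=> [l lk|I Ik J Jk]; first by rewrite -hm // h1.
    have := h2 I Ik J Jk; rewrite /row_step (@eq_cyl2 _ (mm f') _ (nn f')); last 2 first.
    + by move=> l lI; apply: hm; exact: leq_trans lI Ik.
    + by move=> l lJ; apply: hn; rewrite -ltnS; exact: leq_trans lJ Jk.
    by move=> [? a ? ? b]; split=> // l lk; rewrite -(hn l lk); [exact: a|exact: b].
  have hm l : (l < k./2)%N -> mm f l = mm f' l by move=> lk; apply: ff'; lia.
  have hn l : (l < k./2)%N -> nn f l = nn f' l by move=> lk; apply: ff'; lia.
  move=> [h1 h2]; split=> [l lk|I Ik J Jk]; first by rewrite -hn // h1.
  have := h2 I Ik J Jk; rewrite /col_step (@eq_cyl2 _ (mm f') _ (nn f')); last 2 first.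
  + by move=> l lI; apply: hm; exact: leq_trans lI Ik.
  + by move=> l lJ; apply: hn; exact: leq_trans lJ Jk.
  by move=> [? a ? ? b]; split=> // l lk; rewrite -(hm l lk); [exact: a|exact: b].
- rewrite /P; case: (odd k).
    suff : \forall x \near U, Pm k./2 (mm f) (nn f) x by move=> /filter_ex.
    near=> x; split; near: x.
      by apply: near_ltn => l; exact: near_ultra_ge.
    by apply: near_level => I; apply: near_level => J; exact: near_row_step.
  suff : \forall x \near U, Pn k./2 (mm f) (nn f) x by move=> /filter_ex.
  near=> x; split; near: x.
    by apply: near_ltn => l; exact: near_ultra_ge.
  by apply: near_level => I; apply: near_level => J; exact: near_col_step.
have hm k : Pm k (mm f) (nn f) (mm f k).
  have := hf k.*2.+1; rewrite /P /= odd_double /= uphalf_double //.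
have hn k : Pn k (mm f) (nn f) (nn f k).
  have := hf k.*2; rewrite /P /= odd_double /= doubleK //.
exists (mm f), (nn f); split.
- by move=> i j ij; have [h _] := hm j; exact: h.
- by move=> i j ij; have [h _] := hn j; exact: h.
- by move=> k I J Ik Jk; have [_ h] := hn k; exact: h.
- by move=> k I J Ik Jk; have [_ h] := hm k; exact: h.
Unshelve. all: by end_near.
Qed.

End Frequencies.

(** * Estimating the bi-tree variation norm *)

Section MaxBounds.
Variable R : realType.

Lemma max_level_ge0 i j (F : dyadic -> dyadic -> R) : 0 <= max_level i j F.
Proof. exact: bigmax_ge_id. Qed.

Lemma max_level_le i j (F : dyadic -> dyadic -> R) b : 0 <= b ->
  (forall I J, level I = i -> level J = j -> F I J <= b) -> max_level i j F <= b.
Proof.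
move=> b0 h; apply: bigmax_le => // I _; apply: bigmax_le => // J _.
exact: h.
Qed.

Lemma max_sign_le (F : bool -> R) b : 0 <= b -> (forall w, F w <= b) -> max_sign F <= b.
Proof. by move=> b0 h; apply: bigmax_le. Qed.

Lemma nneseries_geometric_le (u : nat -> R) (c : R) : 0 <= c ->
  (forall k, 0 <= u k) -> (forall k, u k <= c / (2 ^ k.+1)%:R) ->
  (\sum_(0 <= k <oo) (u k)%:E <= c%:E)%E.
Proof.
move=> c0 u0 uc.
have := @epsilon_trick R (fun=> 0%E) c xpredT (fun=> lexx _) c0.
rewrite [X in (_ <= X + _)%E -> _]eseries0 // add0e; apply: le_trans.
by apply: lee_nneseries => k _; rewrite ?add0e lee_fin.
Qed.

End MaxBounds.

(** Applied with [x], [y] the entries at a parent and a child, [a] the one-sided limit for the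
    parent and [s] the Rademacher perturbation caused by passing to the child. *)
Lemma dist_chain3 (R : realType) (x a s y d : R) :
  `|x - a| < d -> `|s| < d -> `|y - (a + s)| < d -> `|x - y| <= 3 * d.
Proof.
rewrite !ltr_norml ler_norml => /andP[? ?] /andP[? ?] /andP[? ?].
by apply/andP; split; lra.
Qed.

(** Applied when both coordinates pass to children: [a] and [b] are one-sided limits, [l] is the
    iterated limit for the parent, and [s], [t] are the two perturbations. *)
Lemma dist_chain6 (R : realType) (x a l s t b y d : R) :
  `|x - a| < d -> `|a - l| < d -> `|s| < d -> `|t| < d ->
  `|b - (l + s + t)| < d -> `|y - b| < d -> `|x - y| <= 6 * d.
Proof.
rewrite !ltr_norml ler_norml.
move=> /andP[? ?] /andP[? ?] /andP[? ?] /andP[? ?] /andP[? ?] /andP[? ?].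
by apply/andP; split; lra.
Qed.

Section Estimates.
Variables (R : realType) (U : set_system nat).
Hypotheses (ultraU : UltraFilter U) (freeU : forall n : nat, ~ U [set n]).
Variables (D : {linear V2 R -> V2 R}) (hD : is_haar_multiplier D) (M : R).
Hypothesis D_bound : forall I J, `|entry D I J| <= M.
Variables (m n : nat -> nat) (delta : R).
Hypotheses (m_incr : {homo m : i j / (i < j)%N}) (n_incr : {homo n : i j / (i < j)%N}).
Hypothesis delta_gt0 : 0 < delta.
Let e := entry D.
(** The factor $2^{-k-1}$ makes the series sum to [delta]; dividing by [k.+1] offsets the weight
    $k+1$ of the diagonal sums and the number of terms in the inner sums of the other two. *)
Let eps (k : nat) : R := delta / (2 ^ k.+1)%:R / k.+1%:R.
Hypothesis n_step : forall k I J, (level I <= k)%N -> (level J <= k)%N ->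
  col_step U e k m n (eps k) I J (n k).
Hypothesis m_step : forall k I J, (level I <= k)%N -> (level J <= k.+1)%N ->
  row_step U e k m n (eps k) I J (m k).

Let DR := restriction D (rademacher_system R m) (rademacher_system R n).
Local Notation v := (entry DR).
Let one2 : (nat -> bool) -> (nat -> bool) -> R := fun _ _ => 1.
Let lam := iter_lim U e one2.
Let mu0 := iter_lim' U e one2.

Let DR_entry I J :
  v I J = weighted_mean e (m (level I)) (n (level J)) (cyl2 R m n I J).
Proof. exact: entry_rademacher. Qed.

Let eps_gt0 k : 0 < eps k.
Proof. by rewrite /eps !divr_gt0 // ltr0n expn_gt0. Qed.

Let eps_decr k : eps k.+1 <= eps k.
Proof.
rewrite /eps -!mulrA ler_pM2l // -!invfM lef_pV2 ?posrE ?mulr_gt0 ?ltr0n ?expn_gt0 //.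
by rewrite -!natrM ler_nat leq_mul // leq_exp2l.
Qed.

Let eT_bound I J : `|(fun I J => e J I) I J| <= M. Proof. exact: D_bound. Qed.

Let col_childl j I J w : let g := cyl2 R m n I J in
  col_lim U e j (cyl2 R m n (child I w) J) =
  col_lim U e j g + (-1) ^+ (~~ w) * col_lim U e j (xrad g (m (level I))).
Proof.
move=> g; rewrite cyl2_childl (col_lim_lin ultraU D_bound) //.
  exact: bounded2_cyl2.
by apply: bounded2_xrad; exact: bounded2_cyl2.
Qed.

Let iter_childl I J w : let g := cyl2 R m n I J in
  iter_lim U e (cyl2 R m n (child I w) J) =
  iter_lim U e g + (-1) ^+ (~~ w) * iter_lim U e (xrad g (m (level I))).
Proof.
move=> g; rewrite cyl2_childl (iter_lim_lin ultraU D_bound) //.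
  exact: bounded2_cyl2.
by apply: bounded2_xrad; exact: bounded2_cyl2.
Qed.

Let iter_childr I J w : let g := cyl2 R m n I J in
  iter_lim U e (cyl2 R m n I (child J w)) =
  iter_lim U e g + (-1) ^+ (~~ w) * iter_lim U e (yrad g (n (level J))).
Proof.
move=> g; rewrite cyl2_childr (iter_lim_lin ultraU D_bound) //.
  exact: bounded2_cyl2.
by apply: bounded2_yrad; exact: bounded2_cyl2.
Qed.

Let row_childr i I J w : let g := cyl2 R m n I J in
  row_lim U e i (cyl2 R m n I (child J w)) =
  row_lim U e i g + (-1) ^+ (~~ w) * row_lim U e i (yrad g (n (level J))).
Proof.
move=> g; rewrite cyl2_childr /row_lim -(col_lim_lin ultraU eT_bound) //.
  by apply: bounded2_swap; exact: bounded2_cyl2.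
by apply: bounded2_swap; apply: bounded2_yrad; exact: bounded2_cyl2.
Qed.

Let iter'_childl I J w : let g := cyl2 R m n I J in
  iter_lim' U e (cyl2 R m n (child I w) J) =
  iter_lim' U e g + (-1) ^+ (~~ w) * iter_lim' U e (xrad g (m (level I))).
Proof.
move=> g; rewrite cyl2_childl /iter_lim' -(iter_lim_lin ultraU eT_bound) //.
  by apply: bounded2_swap; exact: bounded2_cyl2.
by apply: bounded2_swap; apply: bounded2_xrad; exact: bounded2_cyl2.
Qed.

Let iter'_childr I J w : let g := cyl2 R m n I J in
  iter_lim' U e (cyl2 R m n I (child J w)) =
  iter_lim' U e g + (-1) ^+ (~~ w) * iter_lim' U e (yrad g (n (level J))).
Proof.
move=> g; rewrite cyl2_childr /iter_lim' -(iter_lim_lin ultraU eT_bound) //.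
  by apply: bounded2_swap; exact: bounded2_cyl2.
by apply: bounded2_swap; apply: bounded2_yrad; exact: bounded2_cyl2.
Qed.

(** Here [n (level J)] is fixed before [m (level I)], so both entries are close to column limits in
    the same column, which differ by a small [xrad] term. *)
Lemma variation_left I J w : (level J <= level I)%N ->
  `|v I J - v (child I w) J| <= 3 * eps (level I).
Proof.
move=> JI; rewrite !DR_entry.
have [_ /(_ _ JI) h1 _ _ /(_ _ JI) h2] := m_step (leqnn (level I)) (leqW JI).
have [_ /(_ (level J) (leqW JI)) h3 _ _ _] :=
  @m_step (level I).+1 (child I w) J (leqnn _) (leqW (leqW JI)).
apply: (dist_chain3 h1 (s := (-1) ^+ (~~ w) * _)); first by rewrite normrMsign; exact: h2.
by rewrite -col_childl; apply: lt_le_trans h3 (eps_decr _).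
Qed.

Lemma variation_right I J w : (level I < level J)%N ->
  `|v I J - v I (child J w)| <= 3 * eps (level J).
Proof.
move=> IJ; rewrite !DR_entry.
have [_ /(_ _ IJ) h1 _ _ /(_ _ IJ) h2] := n_step (ltnW IJ) (leqnn (level J)).
have [_ /(_ (level I) (leqW IJ)) h3 _ _ _] :=
  @n_step (level J).+1 I (child J w) (leqW (ltnW IJ)) (leqnn _).
apply: (dist_chain3 h1 (s := (-1) ^+ (~~ w) * _)); first by rewrite normrMsign; exact: h2.
by rewrite -row_childr; apply: lt_le_trans h3 (eps_decr _).
Qed.

(** Both frequencies change, so the two entries belong to different columns; they are compared
    through [iter_lim], to which both column limits are close. *)
Lemma variation_diag I J w z : level I = level J ->
  `|v I J - v (child I w) (child J z)| <= 6 * eps (level I).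
Proof.
move=> IJ; rewrite !DR_entry.
have JI : (level J <= level I)%N by rewrite IJ.
have [_ /(_ _ JI) h1 _ _ _] := m_step (leqnn (level I)) (leqW JI).
have [h2 _ h3 _ _] := n_step (leqnn (level I)) JI.
(* The coordinates are changed one at a time, first [J] and then [I]; the intermediate pair has
   second level [(level I).+1], just within the range of [m_step]. *)
have [_ _ h4 _ _] := @m_step (level I) I (child J z) (leqnn _) JI.
have [h5 _ _ _ _] := @n_step (level I).+1 (child I w) (child J z) (leqnn _) JI.
have [_ /(_ (level (child J z)) JI) h6 _ _ _] :=
  @m_step (level I).+1 (child I w) (child J z) (leqnn _) (leqW JI).
have eJ : level (child J z) = (level I).+1 by rewrite IJ.
move: h2 h3 h5 h6; rewrite eJ -IJ in h1 * => h2 h3 h5 h6.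
apply: (dist_chain6 h1 h2 (s := (-1) ^+ (~~ z) * _) (t := (-1) ^+ (~~ w) * _)).
- by rewrite normrMsign; exact: h3.
- by rewrite normrMsign; exact: h4.
- have := lt_le_trans h5 (eps_decr _).
  by rewrite iter_childl iter_childr -IJ; apply.
- exact: lt_le_trans h6 (eps_decr _).
Qed.

(** Now [m (level I)] precedes [n (level J)], so row limits and the opposite iterated limit
    [iter_lim'] take over. *)
Lemma variation_subdiag I J w z : level J = (level I).+1 ->
  `|v I J - v (child I w) (child J z)| <= 6 * eps (level I).
Proof.
move=> JI; rewrite !DR_entry.
have Jk : (level J <= (level I).+1)%N by rewrite JI.
have [h1 _ _ h3 _] := m_step (leqnn (level I)) Jk.
have [_ /(_ _ (leqnn _)) h2 _ _ _] := @n_step (level I).+1 I J (leqnSn _) Jk.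
have [_ _ _ h4 _] := @n_step (level I).+1 (child I w) J (leqnn _) Jk.
have [h5 _ _ _ _] := @m_step (level I).+1 (child I w) (child J z) (leqnn _) Jk.
have [_ /(_ (level I).+1 (leqnn _)) h6 _ _ _] :=
  @n_step (level I).+2 (child I w) (child J z) (leqnSn _) Jk.
have eJ : level (child J z) = (level I).+2 by rewrite -JI.
have d1 := eps_decr (level I); have d2 := le_trans (eps_decr (level I).+1) d1.
rewrite eJ JI; apply: (dist_chain6 (lt_le_trans h2 d1) h1
  (s := (-1) ^+ (~~ w) * _) (t := (-1) ^+ (~~ z) * _)).
- by rewrite normrMsign; exact: h3.
- by rewrite normrMsign; exact: lt_le_trans h4 d1.
- by have := lt_le_trans h5 d1; rewrite iter'_childr iter'_childl JI; apply.
- exact: lt_le_trans h6 d2.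
Qed.

Let cyl2_unit : cyl2 R m n unit_interval unit_interval = one2.
Proof.
apply/funext => x; apply/funext => y.
by rewrite /cyl2 /cyl /agree /len /= expr0 invr1 divr1 mul1r.
Qed.

Lemma entry_unit : `|v unit_interval unit_interval - lam| <= 2 * eps 0.
Proof.
rewrite DR_entry.
have [_ /(_ 0%N (leqnn _)) h1 _ _ _] :=
  @m_step 0 unit_interval unit_interval (leqnn _) (leqnSn _).
have [h2 _ _ _ _] := @n_step 0 unit_interval unit_interval (leqnn _) (leqnn _).
move: h1 h2; rewrite cyl2_unit -/lam !ltr_norml ler_norml.
move=> /andP[? ?] /andP[? ?]; apply/andP; split; rewrite /=; lra.
Qed.

(** This entry involves [m 0] and [n 1], chosen in this order, hence approximates [mu0]; the third
    error is the perturbation of the constant weight by digit [n 0]. *)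
Lemma entry_unit_child w :
  `|v unit_interval (child unit_interval w) - mu0| <= 3 * eps 0.
Proof.
rewrite DR_entry.
have [h1 _ _ _ _] := @m_step 0 unit_interval (child unit_interval w) (leqnn _) (leqnn _).
have [_ /(_ 0%N (leqnn _)) h2 _ _ _] :=
  @n_step 1 unit_interval (child unit_interval w) (leqnSn _) (leqnn _).
have [_ _ _ h3 _] := @n_step 0 unit_interval unit_interval (leqnn _) (leqnn _).
have d0 := eps_decr 0.
move: h1 h2 h3; rewrite iter'_childr -(normrMsign (~~ w) (iter_lim' U e (yrad _ _))).
rewrite cyl2_unit -/mu0 !ltr_norml ler_norml.
move=> /andP[? ?] /andP[? ?] /andP[? ?]; apply/andP; split; rewrite /=; lra.
Qed.

Let eps_mul k : k.+1%:R * eps k = delta / (2 ^ k.+1)%:R.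
Proof. by rewrite /eps mulrCA mulfV ?mulr1 // pnatr_eq0. Qed.

Let T := (DR - (lam *: @capon R + mu0 *: (idfun - @capon R)))%R.

Let entry_T I J : entry T I J = v I J - (if (level J <= level I)%N then lam else mu0).
Proof.
by apply: (entry_sub_capon hD) => ? ? ?; exact: cells_disj.
Qed.

(** In each of the four sums the two compared pairs lie on the same side of the Capon diagonal, so
    the subtracted constants cancel and only variations of [DR] remain. The sums contribute 6, 6, 3
    and 3 times [delta]. *)
Lemma T2S_norm_le : (T2S_norm T <= (18 * delta)%:E)%E.
Proof.
have d0 : 0 <= delta := ltW delta_gt0.
have e0 k : 0 <= eps k := ltW (eps_gt0 k).
rewrite /T2S_norm /=.
have -> : 18 * delta = 6 * delta + 6 * delta + 3 * delta + 3 * delta by ring.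
rewrite !EFinD; apply: leeD; last first.
  apply: nneseries_geometric_le; first by rewrite mulr_ge0.
    by move=> k; apply: sumr_ge0 => i _; exact: max_level_ge0.
  move=> j; rewrite -mulrA -eps_mul.
  have -> : 3 * (j.+1%:R * eps j) = \sum_(0 <= i < j.+1) (3 * eps j).
    by rewrite sumr_const_nat subn0 -[RHS]mulr_natl mulrCA.
  rewrite big_nat [leRHS]big_nat; apply: ler_sum => i /andP[_ ij].
  apply: max_level_le => [|I J lI lJ]; first by rewrite mulr_ge0.
  apply: max_sign_le => [|w]; first by rewrite mulr_ge0.
  have IJ : (level I < level J)%N by rewrite lI lJ.
  rewrite !entry_T !ifF; last 2 first.
  - by apply: negbTE; rewrite -ltnNge; exact: leqW.
  - by apply: negbTE; rewrite -ltnNge.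
  rewrite opprB addrA subrK; apply: le_trans (variation_right w IJ) _.
  (* In the fourth sum [J] has level [j.+1], so the variation is even bounded with [eps j.+1]. *)
  by rewrite lJ ler_pM2l // eps_decr.
apply: leeD; last first.
  apply: nneseries_geometric_le; first by rewrite mulr_ge0.
    by move=> k; apply: sumr_ge0 => i _; exact: max_level_ge0.
  move=> i; rewrite -mulrA -eps_mul.
  have -> : 3 * (i.+1%:R * eps i) = \sum_(0 <= j < i.+1) (3 * eps i).
    by rewrite sumr_const_nat subn0 -[RHS]mulr_natl mulrCA.
  rewrite big_nat [leRHS]big_nat; apply: ler_sum => j /andP[_ ji].
  apply: max_level_le => [|I J lI lJ]; first by rewrite mulr_ge0.
  apply: max_sign_le => [|w]; first by rewrite mulr_ge0.
  have JI : (level J <= level I)%N by rewrite lI lJ.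
  rewrite !entry_T !ifT //; last exact: leqW.
  rewrite opprB addrA subrK -lI; exact: variation_left.
apply: leeD.
  apply: nneseries_geometric_le; first by rewrite mulr_ge0.
    by move=> k; rewrite mulr_ge0 // max_level_ge0.
  move=> k; rewrite -mulrA -eps_mul mulrCA ler_pM2l //.
  apply: max_level_le => [|I J lI lJ]; first by rewrite mulr_ge0.
  apply: max_sign_le => [|w]; first by rewrite mulr_ge0.
  apply: max_sign_le => [|z]; first by rewrite mulr_ge0.
  have JI : (level J <= level I)%N by rewrite lI lJ.
  have JI' : (level (child J z) <= level (child I w))%N := JI.
  rewrite !entry_T JI JI'.
  by rewrite opprB addrA subrK -lI; apply: variation_diag; rewrite lI.
apply: nneseries_geometric_le; first by rewrite mulr_ge0.
  by move=> k; rewrite mulr_ge0 // max_level_ge0.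
move=> k; rewrite -mulrA -eps_mul mulrCA ler_pM2l //.
apply: max_level_le => [|I J lI lJ]; first by rewrite mulr_ge0.
apply: max_sign_le => [|w]; first by rewrite mulr_ge0.
apply: max_sign_le => [|z]; first by rewrite mulr_ge0.
have JI : (level J <= level I)%N = false by rewrite lI lJ ltnn.
have JI' : (level (child J z) <= level (child I w))%N = false := JI.
rewrite !entry_T JI JI'.
by rewrite opprB addrA subrK -lI; apply: variation_subdiag; rewrite lI.
Qed.

Lemma T2_norm_le : (T2_norm T <= (23 * delta)%:E)%E.
Proof.
have e0 : eps 0 = delta / 2 by have := eps_mul 0; rewrite mul1r.
(* The entry at the unit square costs [2 * eps 0 = delta]; each of the other two costs [3 * eps 0],
   which is rounded up to [2 * delta]. *)
have -> : 23 * delta = 18 * delta + 1 * delta + 2 * delta + 2 * delta by ring.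
rewrite /T2_norm !EFinD; apply: leeD; last first.
  rewrite lee_fin entry_T /=; apply: le_trans (entry_unit_child false) _.
  by rewrite e0; move: delta_gt0 => d0; lra.
apply: leeD; last first.
  rewrite lee_fin entry_T /=; apply: le_trans (entry_unit_child true) _.
  by rewrite e0; move: delta_gt0 => d0; lra.
apply: leeD; first exact: T2S_norm_le.
rewrite lee_fin entry_T /=; apply: le_trans entry_unit _.
by rewrite e0; move: delta_gt0 => d0; lra.
Qed.

Let eps_small x : 0 < x -> exists N, forall k, (N <= k)%N -> eps k < x.
Proof.
move=> x0; exists (Num.truncn (delta / x)).+1 => k Nk.
apply: le_lt_trans (_ : delta / k.+1%:R < x).
  rewrite /eps ler_wpM2r ?invr_ge0 // ler_pdivrMr ?ltr0n ?expn_gt0 //.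
  by rewrite ler_peMr ?(ltW delta_gt0) // ler1n expn_gt0.
rewrite ltr_pdivrMr // mulrC -ltr_pdivrMr //.
have /andP[_ h] := truncn_itv (divr_ge0 (ltW delta_gt0) (ltW x0)).
by apply: (lt_le_trans h); rewrite ler_nat; exact: leqW.
Qed.

Let ulim_dist (u : nat -> R) l N : (forall k, (N <= k)%N -> `|u k - l| < eps k) ->
  ulim U u = l.
Proof.
move=> h; apply: (ulim_eq ultraU) => x /eps_small[N' hN'].
apply: filterS2 (near_ultra_ge ultraU freeU N) (near_ultra_ge ultraU freeU N') => k Nk N'k.
exact: lt_trans (h k Nk) (hN' k N'k).
Qed.

(** With the constant weight, the step conditions give genuine convergence along [m] and [n] to the
    limits of [D] along [U]; since [U] contains all tails, the limits along [U] agree. *)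
Lemma lambda_rademacher : lambda U DR = lam.
Proof.
rewrite /lambda.
have -> : (fun j => lim (block_mean DR i j @[i --> U])) = fun j => col_lim U e (n j) one2.
  apply/funext => j; apply: (@ulim_dist _ _ j) => i ji.
  rewrite block_mean_rademacher //.
  have [_ /(_ _ ji) + _ _ _] := @m_step i unit_interval unit_interval (leq0n _) (leq0n _).
  by rewrite cyl2_unit.
apply: (@ulim_dist _ _ 0) => j _.
have [+ _ _ _ _] := @n_step j unit_interval unit_interval (leq0n _) (leq0n _).
by rewrite cyl2_unit.
Qed.

Lemma mu_rademacher : mu U DR = mu0.
Proof.
rewrite /mu.
have -> : (fun i => lim (block_mean DR i j @[j --> U])) = fun i => row_lim U e (m i) one2.
  (* The tail starts at [i.+1] because [n j] is chosen after [m i] only for [i < j]; for [lambda] it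
     starts at [j], as [n j] precedes [m j]. *)
  apply/funext => i; apply: (@ulim_dist _ _ i.+1) => j ij.
  rewrite block_mean_rademacher //.
  have [_ /(_ _ ij) + _ _ _] := @n_step j unit_interval unit_interval (leq0n _) (leq0n _).
  by rewrite cyl2_unit.
apply: (@ulim_dist _ _ 0) => i _.
have [+ _ _ _ _] := @m_step i unit_interval unit_interval (leq0n _) (leq0n _).
by rewrite cyl2_unit.
Qed.

End Estimates.

(** * The two functionals as iterated limits, and conclusion *)

Lemma block_meanE (R : realType) (D : V2 R -> V2 R) :
  block_mean D = fun i j => weighted_mean (entry D) i j (fun _ _ => 1).
Proof.
apply/funext => i; apply/funext => j.
by apply: eq_bigr => I _; apply: eq_bigr => J _; rewrite mulr1.
Qed.

Lemma lambdaE (R : realType) U (D : V2 R -> V2 R) :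
  lambda U D = iter_lim U (entry D) (fun _ _ => 1).
Proof. by rewrite /lambda block_meanE. Qed.

Lemma muE (R : realType) U (D : V2 R -> V2 R) :
  mu U D = iter_lim' U (entry D) (fun _ _ => 1).
Proof.
rewrite /mu; have -> : block_mean D =
    fun i j => weighted_mean (fun I J => entry D J I) j i (fun _ _ => 1); last by [].
rewrite block_meanE; apply/funext => i; apply/funext => j.
exact: weighted_mean_swap.
Qed.

Theorem theorem2p29 (R : realType) (D : {linear V2 R -> V2 R})
    (hD : is_haar_multiplier D) (bD : (linfty_norm D < +oo)%E)
    (U : set_system nat) (ultraU : UltraFilter U)
    (freeU : forall n : nat, ~ U [set n])
    (eta : R) (eta_gt0 : 0 < eta) :
  exists (ht kt : dyadic -> V1 R) (m n : nat -> nat),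
    [/\ faithful_haar_system_rel ht m,
        faithful_haar_system_rel kt n,
        (T2_norm (restriction D ht kt
                  - (lambda U D *: @capon R
                     + mu U D *: (idfun - @capon R)))%R < eta%:E)%E,
        lambda U D = lambda U (restriction D ht kt) &
        mu U D = mu U (restriction D ht kt)].
Proof.
have D_bound I J : `|entry D I J| <= fine (linfty_norm D).
  have h : (`|entry D I J|%:E <= linfty_norm D)%E by apply: ereal_sup_ubound; exists (I, J).
  rewrite -lee_fin fineK // ge0_fin_numE //.
  by apply: le_trans h; rewrite lee_fin.
(* The norm is at most [23 * delta], so 24 gives the strict inequality. *)
pose delta := eta / 24.
have delta_gt0 : 0 < delta by rewrite divr_gt0.
pose eps (k : nat) : R := delta / (2 ^ k.+1)%:R / k.+1%:R.
have eps_gt0 k : 0 < eps k by rewrite /eps !divr_gt0 // ltr0n expn_gt0.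
have [m [n [m_incr n_incr n_step m_step]]] := frequencies ultraU freeU D_bound eps_gt0.
exists (rademacher_system R m), (rademacher_system R n), m, n.
rewrite lambdaE muE; split; [exact: rademacher_faithful|exact: rademacher_faithful| | |].
- apply: le_lt_trans (T2_norm_le ultraU hD D_bound m_incr n_incr delta_gt0 n_step m_step) _.
  by rewrite lte_fin /delta; lra.
- by rewrite (lambda_rademacher ultraU freeU hD m_incr n_incr delta_gt0 n_step m_step).
- by rewrite (mu_rademacher ultraU freeU hD m_incr n_incr delta_gt0 n_step m_step).
Qed.
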